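(* Let $k\ge 2$ be an integer and let $\mathcal{I},\mathcal{J}$ be finite subsets of $\Lambda_k$ with $\mathcal{I}\cap\mathcal{J}=\varnothing$. Then the set \[ \mathcal{B}_{\mathcal{I},\mathcal{J}}^{(k)}:=\Big\{n\in\mathbb{Z}_{\ge1}\ \Big|\ \#\big((n^k,(n+1)^k)\cap\mathcal{S}_{\mathcal{I}}\big)=\#\mathcal{I},\ \#\big(((n+1)^k,(n+2)^k)\cap\mathcal{S}_{\mathcal{J}}\big)=\#\mathcal{J},\ (n^k,(n+2)^k)\cap\mathcal{S}_{\Lambda_k\setminus(\mathcal{I}\cup\mathcal{J})}=\varnothing\Big\} \] has positive asymptotic density \[ d(\mathcal{B}_{\mathcal{I},\mathcal{J}}^{(k)})=\prod_{\lambda\in\mathcal{I}\cup\mathcal{J}}\frac{1}{\lambda}\cdot\prod_{\lambda\in\Lambda_k\setminus(\mathcal{I}\cup\mathcal{J})}\Big(1-\frac{2}{\lambda}\Big). \]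
   Context: Let $k\ge2$ be an integer. A positive integer $n$ is $k$-full if $p^k\mid n$ for every prime $p\mid n$. Let $\mathcal{S}_k$ be the set of $k$-full integers that are not perfect $k$th powers. Define \[ \Lambda_k:=\Big\{(b_1^{k+1}b_2^{k+2}\cdots b_{k-1}^{2k-1})^{1/k}\ \Big|\ b_1,\dots,b_{k-1}\in\mathbb{Z}_{\ge1},\ b_1\cdots b_{k-1}\ge2,\ b_1\cdots b_{k-1}\text{ squarefree}\Big\}, \] a set of real numbers $>2$ (every $k$-full integer is uniquely $a^k\lambda^k$ with $a\in\mathbb{Z}_{\ge1}$, $\lambda\in\Lambda_k\cup\{1\}$). For nonempty $\mathcal{I}\subseteq\Lambda_k$ let $\mathcal{S}_{\mathcal{I}}:=\{a^k\lambda^k\mid a\in\mathbb{Z}_{\ge1},\lambda\in\mathcal{I}\}$, and $\mathcal{S}_\varnothing:=\varnothing$; thus $\mathcal{S}_{\Lambda_k}=\mathcal{S}_k$. For a set $\mathcal{A}\subseteq\mathbb{Z}_{\ge1}$, $\#\mathcal{A}(x)$ is the number of elements of $\mathcal{A}$ not exceeding $x$, and the asymptotic density is $d(\mathcal{A}):=\lim_{x\to\infty}\#\mathcal{A}(x)/x$ when the limit exists. (The infinite product converges since $\sum_{\lambda\in\Lambda_k}1/\lambda<\infty$.) *)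

(* Defs.v *)
From HB Require Import structures.
From mathcomp Require Import all_boot all_order all_algebra.
From mathcomp Require Import all_classical all_reals all_analysis.
Set Implicit Arguments. Unset Strict Implicit. Unset Printing Implicit Defensive.
Import Order.TTheory GRing.Theory Num.Theory.
Local Open Scope classical_set_scope.
Local Open Scope ring_scope.

Definition squarefree (n : nat) : Prop :=
  forall p : nat, prime p -> ~~ (p * p %| n)%N.

Section Defs.
Variable R : realType.

Definition inLambda (k : nat) (l : R) : Prop :=
  exists b : nat -> nat,
    (forall i : nat, (1 <= i < k)%N -> (0 < b i)%N) /\
    (2 <= \prod_(1 <= i < k) b i)%N /\
    squarefree (\prod_(1 <= i < k) b i) /\
    l = ((\prod_(1 <= i < k) b i ^ (k + i))%N%:R) `^ (k%:R^-1).

Definition inS (k : nat) (P : R -> Prop) (m : nat) : Prop :=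
  exists a : nat, (0 < a)%N /\ exists l : R, P l /\ m%:R = a%:R ^+ k * l ^+ k.

(* # ((lo, hi) \cap S_P), lo hi integers; S_P consists of positive integers *)
Definition cnt_open (k : nat) (P : R -> Prop) (lo hi : nat) : nat :=
  count (fun m => `[< inS k P m >]) (index_iota lo.+1 hi).

Definition inB (k : nat) (I J : seq R) (n : nat) : Prop :=
  (0 < n)%N /\
  cnt_open k (fun l => l \in I) (n ^ k) (n.+1 ^ k) = size I /\
  cnt_open k (fun l => l \in J) (n.+1 ^ k) (n.+2 ^ k) = size J /\
  cnt_open k (fun l => inLambda k l /\ l \notin I /\ l \notin J)
    (n ^ k) (n.+2 ^ k) = 0%N.

Definition countB (k : nat) (I J : seq R) (x : R) : nat :=
  count (fun n => `[< inB k I J n >]) (iota 1 (Num.truncn x)).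

(* partial product of (1 - 2/l) over l in Lambda_k \ (I u J), l <= X
   (a finite set) *)
Definition partial_prod (k : nat) (I J : seq R) (X : R) : R :=
  \big[*%R/1]_(l \in [set l : R | inLambda k l /\ l \notin I /\ l \notin J /\ l <= X])
     (1 - 2 / l).

End Defs.

(* Main.v *)
Require Import Defs.
From HB Require Import structures.
From mathcomp Require Import all_boot all_order all_algebra all_field finmap.
From mathcomp Require Import all_classical all_reals all_analysis.
From mathcomp Require Import zify ring lra.
Import Order.TTheory GRing.Theory Num.Theory numFieldNormedType.Exports.
Set Implicit Arguments. Unset Strict Implicit. Unset Printing Implicit Defensive.
Local Open Scope classical_set_scope.
Local Open Scope ring_scope.

(** Write [th = 1 / l] for [l] in [Lambda_k]. An element [a^k l^k] lies between
    [n^k] and [n.+1^k] exactly when the integer [a] lies between [n th] and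
    [n.+1 th]; since [l] is irrational and greater than [2], the indicator of this
    event is [th + {n th} - {n.+1 th}]. Besicovitch's theorem on real radicals
    (proved with traces of multiplication matrices) shows that [1] and the numbers
    [th] are linearly independent over the rationals, so averages of products of
    trigonometric polynomials in the [n th] factor. The sawtooth is approximated in
    mean by its discrete convolution with the Fejer kernel, hence the events attached
    to finitely many [l] are asymptotically independent. The [l > X] contribute
    density at most [O (\sum_(l > X) 1 / l)], which tends to [0] with [1 / X]. *)

(** * Linear independence of real radicals *)

(** Each event is a condition on the position of [n * th] modulo 1, so a joint density over several
    [l] is an equidistribution statement on a torus. It would in general fail under an integer
    relation between the [th], which is why irrationality of each [th] is not enough. The indicators
    are discontinuous, hence not uniformly close to trigonometric polynomials; closeness in mean
    suffices because all factors are bounded by 1. The infinitely many [l] are kept under control by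
    two facts: a hit by [l] at [n] forces [l <= n.+1], so only finitely many elements matter up to a
    given height, and [\sum 1 / l] converges by comparison with a product of zeta sums at
    [1 + 1 / k]. *)

Section RadicalTrace.
Variables (R : realFieldType) (q : rat) (d : nat) (al : R).
Hypotheses (al_gt0 : 0 < al) (d_gt1 : (1 < d)%N) (al_d : al ^+ d = ratr q).
Hypothesis d_min : forall e r, (0 < e < d)%N -> al ^+ e != ratr r.

(** In absolute value the constant coefficient is the product of the roots [z], and [|z| ^+ d = q]
    for each of them. So it has the same [d]-th power as [al ^+ (size f).-1]. The roots lie in
    [algC] and [al] in [R]; they are compared through rationals only. *)
Lemma radical_conjugates_norm (f : {poly rat}) : f \is monic ->
  (forall z : algC, root (map_poly ratr f) z -> z ^+ d = ratr q) ->
  exists r, al ^+ (size f).-1 = ratr r.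
Proof.
move=> fm fz; have [rs Ef] := closed_field_poly_normal (map_poly ratr f : {poly algC}).
have lf : lead_coef (map_poly ratr f : {poly algC}) = 1.
  by rewrite lead_coef_map (monicP fm) rmorph1.
rewrite lf scale1r in Ef.
have sz : (size f).-1 = size rs.
  by rewrite -(size_map_poly (ratr : {rmorphism rat -> algC})) Ef size_prod_XsubC.
have E0 : `|f`_0| ^+ d = q ^+ size rs.
  have q_ge0 : 0 <= q by rewrite -(ler0q R) -al_d exprn_ge0 // ltW.
  have : (ratr (`|f`_0| ^+ d) : algC) = ratr (q ^+ size rs).
    rewrite !rmorphXn /= ratr_norm.
    have -> : (ratr f`_0 : algC) = \prod_(z <- rs) (- z).
      rewrite -coef_map Ef -horner_coef0 horner_prod.
      by apply: eq_bigr => z _; rewrite !hornerE.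
    rewrite normr_prod -prodrXl big_seq (eq_bigr (fun=> ratr q)) => [|z zrs].
      by rewrite -big_seq big_const_seq count_predT iter_mulr_1.
    rewrite normrN -normrX fz ?ger0_norm ?ler0q //.
    by rewrite Ef root_prod_XsubC.
  by move/fmorph_inj.
exists `|f`_0|; rewrite sz.
have : (al ^+ size rs) ^+ d = (ratr `|f`_0|) ^+ d.
  by rewrite -exprM mulnC exprM al_d -!rmorphXn /= E0.
by move/eqP; rewrite eqrXn2 ?exprn_ge0 ?ler0q ?(ltW al_gt0) ?(ltn_trans _ d_gt1) // => /eqP.
Qed.

(** Minimality of [d] makes ['X^d - q] irreducible over the rationals, so [f] is a power of it,
    hence a polynomial in ['X^d] with [d > 1]. The induction divides off one factor at a time. *)
Lemma radical_subleading_coef (f : {poly rat}) : f \is monic -> (1 < size f)%N ->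
  (forall z : algC, root (map_poly ratr f) z -> z ^+ d = ratr q) ->
  f`_(size f).-2 = 0.
Proof.
have [n] := ubnP (size f); elim: n f => // n IH f; rewrite ltnS => fn fm f1 fz.
have d0 : (0 < d)%N by exact: ltn_trans d_gt1.
pose p : {poly rat} := 'X^d - q%:P.
have pm : p \is monic by rewrite monicXnsubC.
have sp : size p = d.+1 by rewrite size_XnsubC.
have rp (z : algC) : root (map_poly ratr p) z = (z ^+ d == ratr q).
  by rewrite rmorphB /= map_polyXn map_polyC /= /root !hornerE subr_eq0.
have pf : p %| f.
  (* The gcd is not constant, since [f] and [p] share a complex root. Its degree is at least [d] by
     [radical_conjugates_norm] and [d_min], so it is [p] up to a unit. *)
  pose g0 := gcdp f p; pose g := (lead_coef g0)^-1 *: g0.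
  have g0n0 : g0 != 0 by rewrite gcdp_eq0 negb_and (monic_neq0 pm) orbT.
  have gm : g \is monic.
    by rewrite monicE lead_coefZ mulVf // lead_coef_eq0.
  have gg0 : g %= g0 by rewrite eqp_scale // invr_eq0 lead_coef_eq0.
  have gp : g %| p by rewrite (eqp_dvdl _ gg0) dvdp_gcdr.
  have gf : g %| f by rewrite (eqp_dvdl _ gg0) dvdp_gcdl.
  have gz (z : algC) : root (map_poly ratr g) z -> z ^+ d = ratr q.
    move=> gz; apply/eqP; rewrite -rp; apply: root_dvdp gz.
    by rewrite dvdp_map.
  have sg : (1 < size g)%N.
    rewrite (eqp_size gg0) -(size_map_poly (ratr : {rmorphism rat -> algC})).
    have nz : map_poly (ratr : rat -> algC) g0 != 0 by rewrite map_poly_eq0.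
    have /closed_rootP[z zf] : size (map_poly (ratr : rat -> algC) f) != 1.
      by rewrite size_map_poly neq_ltn f1 orbT.
    by apply: (root_size_gt1 (a := z)) => //; rewrite gcdp_map root_gcd zf rp fz /=.
  have [r Er] := radical_conjugates_norm gm gz.
  have gd : ((size g).-1 >= d)%N.
    rewrite leqNgt; apply/negP => gd.
    have e0 : (0 < (size g).-1 < d)%N by rewrite gd andbT -ltnS prednK // ltnW.
    by have := d_min r e0; rewrite Er eqxx.
  suff : g %= p by move=> /eqp_dvdl <-.
  rewrite -dvdp_size_eqp // eqn_leq dvdp_leq ?monic_neq0 //= sp.
  by rewrite -(prednK (ltnW sg)) ltnS.
have /dvdpP[g Eg] := pf.
have gm : g \is monic by rewrite -(monicMr _ pm) -Eg.
have sf : size f = (size g + d)%N.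
  by rewrite Eg size_Mmonic ?monic_neq0 // sp addnS.
have g0 : (0 < size g)%N by rewrite size_poly_gt0 monic_neq0.
have [g1|g1] := leqP (size g) 1.
  have sg1 : size g = 1%N by apply/eqP; rewrite eqn_leq g1 g0.
  have g_1 : g = 1 by have := size1_polyC g1 ; move: (monicP gm); rewrite lead_coefE sg1 => -> ->.
  have [e Ed] : exists e, d = e.+2 by exists d.-2; rewrite !prednK // -ltnS prednK.
  rewrite sf sg1 Eg g_1 mul1r /p Ed coefB coefXn coefC /=.
  by rewrite ltn_eqF ?subr0.
have E : (size f).-2 = ((size g).-2 + d)%N by rewrite sf; move: g1; clear; lia.
rewrite E Eg mulrBr coefB coefMXn coefMC.
rewrite ltnNge leq_addl /= addnK [g`_(_ + _)]nth_default ?mul0r ?subr0; last first.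
  by move: g1; case: (size g) => [|[|m]] //= _; rewrite -addn2 leq_add2l.
apply: IH => //; first by apply: leq_trans fn; rewrite sf -addn1 leq_add2l.
move=> z gz; apply: fz; rewrite Eg rmorphM /= rootM gz //.
Qed.

End RadicalTrace.

(** The trace is minus the subleading coefficient of the characteristic polynomial, and
    [M ^+ d = q%:M] makes every complex eigenvalue a [d]-th root of [q]. *)
Lemma mxtrace_radical (R : realFieldType) (q : rat) (d : nat) (al : R) n
    (M : 'M[rat]_n.+1) : 0 < al -> (1 < d)%N -> al ^+ d = ratr q ->
  (forall e r, (0 < e < d)%N -> al ^+ e != ratr r) ->
  M ^+ d = q%:M -> \tr M = 0.
Proof.
move=> al0 d1 ald dmin Md; apply/eqP; rewrite -oppr_eq0 -char_poly_trace //.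
rewrite (_ : n.+1.-1 = (size (char_poly M)).-2); last by rewrite size_char_poly.
rewrite (radical_subleading_coef al0 d1 ald dmin) ?char_poly_monic ?size_char_poly //.
move=> z; rewrite map_char_poly -eigenvalue_root_char => /eigenvalueP[v vM v0].
have E e : v *m (map_mx ratr M) ^+ e = z ^+ e *: v.
  elim: e => [|e IH]; first by rewrite !expr0 mulmx1 scale1r.
  by rewrite exprSr -mulmxE mulmxA IH -scalemxAl vM scalerA -exprSr.
have := E d; rewrite -rmorphXn /= Md map_scalar_mx /= mul_mx_scalar => /eqP.
rewrite -subr_eq0 -scalerBl scaler_eq0 (negPf v0) orbF subr_eq0 => /eqP -> //.
Qed.

(** * Rational subspaces stable under multiplication by radicals *)

Section RationalSpan.
Variable R : realFieldType.

Definition qspan (T : finType) (w : T -> R) (x : R) : Prop :=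
  exists c : T -> rat, x = \sum_t ratr (c t) * w t.

Definition qfree (T : finType) (w : T -> R) : Prop :=
  forall c : T -> rat, \sum_t ratr (c t) * w t = 0 -> forall t, c t = 0.

Lemma qspanD (T : finType) (w : T -> R) x y :
  qspan w x -> qspan w y -> qspan w (x + y).
Proof.
move=> [c ->] [e ->]; exists (fun t => c t + e t).
by rewrite -big_split; apply: eq_bigr => t _; rewrite rmorphD mulrDl.
Qed.

Lemma qspanZ (T : finType) (w : T -> R) (q : rat) x :
  qspan w x -> qspan w (ratr q * x).
Proof.
move=> [c ->]; exists (fun t => q * c t).
by rewrite mulr_sumr; apply: eq_bigr => t _; rewrite rmorphM mulrA.
Qed.

Lemma qspan0 (T : finType) (w : T -> R) : qspan w 0.
Proof.
exists (fun=> 0); rewrite big1 // => t _.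
by rewrite raddf0 mul0r.
Qed.

Lemma qspan_sum (T S : finType) (P : pred S) (w : T -> R) (F : S -> R) :
  (forall i, P i -> qspan w (F i)) -> qspan w (\sum_(i | P i) F i).
Proof.
move=> h; apply: (big_ind (qspan w)) => //; first exact: qspan0.
exact: qspanD.
Qed.

Lemma qspan_id (T : finType) (w : T -> R) t : qspan w (w t).
Proof.
exists (fun u => (u == t)%:R); rewrite (bigD1 t) //= eqxx rmorph1 mul1r big1 ?addr0 //.
by move=> u /negPf ->; rewrite raddf0 mul0r.
Qed.

Lemma qspan_trans (T S : finType) (w : T -> R) (w' : S -> R) x :
  (forall t, qspan w' (w t)) -> qspan w x -> qspan w' x.
Proof.
by move=> h [c ->]; apply: qspan_sum => t _; apply/qspanZ/h.
Qed.

Definition qstable (s : seq R) (T : finType) (w : T -> R) : Prop :=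
  (exists t, w t != 0) /\ forall x t, x \in s -> qspan w (x * w t).

(** Adjoining [x] multiplies the generators by [1, x, ..., x ^+ k.-1]; exponents wrap around through
    [x ^+ k = ratr q]. *)
Lemma exists_qstable (k : nat) (s : seq R) : (0 < k)%N ->
  (forall x, x \in s -> exists q : rat, x ^+ k = ratr q) ->
  exists (T : finType) (w : T -> R), qstable s w.
Proof.
move=> k0; elim: s => [|x s IH] h.
  by exists unit, (fun=> 1); split => //; exists tt; rewrite oner_eq0.
have [y ys|T [w [[t0 wt0] st]]] := IH; first by apply: h; rewrite inE ys orbT.
have [q Eq] := h x (mem_head _ _).
pose w' (u : T * 'I_k) := w u.1 * x ^+ u.2; exists (T * 'I_k)%type, w'; split.
  by exists (t0, Ordinal k0); rewrite /w' expr0 mulr1.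
move=> y [t e]; rewrite {2}/w' /= inE => /orP[/eqP ->|ys].
  have [ek|ek] := ltnP e.+1 k.
    by rewrite mulrCA -exprS; exact: (qspan_id _ (t, Ordinal ek)).
  have ek' : e.+1 = k by apply/eqP; rewrite eqn_leq ek (ltn_ord e).
  rewrite mulrCA -exprS ek' Eq mulrC; apply: qspanZ.
  rewrite -[w t]mulr1 -(expr0 x); exact: (qspan_id _ (t, Ordinal k0)).
have [c Ec] := st y t ys; rewrite mulrA Ec mulr_suml.
apply: qspan_sum => u _; rewrite -mulrA; apply: qspanZ; exact: (qspan_id _ (u, e)).
Qed.

(** A stable family of least size is free: a nontrivial relation would express one generator through
    the others and leave a smaller stable family. *)
Lemma exists_qstable_basis (k : nat) (s : seq R) : (0 < k)%N ->
  (forall x, x \in s -> exists q : rat, x ^+ k = ratr q) ->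
  exists n (w : 'I_n.+1 -> R), qfree w /\ qstable s w.
Proof.
move=> k0 h; have [T [w [[t0 wt0] st]]] := exists_qstable k0 h.
have ex : exists n, `[< exists w : 'I_n -> R, qstable s w >].
  exists #|T|; apply/asboolP; exists (w \o enum_val); split.
    by exists (enum_rank t0); rewrite /= enum_rankK.
  move=> x t xs; apply: qspan_trans (st _ _ xs) => u.
  by rewrite -[u]enum_rankK; exact: (qspan_id (w \o enum_val)).
case: (ex_minnP ex) => -[|n] /asboolP[v [[t1 vt1] sv]] nmin; first by case: t1 vt1.
exists n, v; split; last by split=> //; exists t1.
move=> c c0 t; apply/eqP; apply: contraT => ct.
have vt : qspan (v \o lift t) (v t).
  move: c0; rewrite (bigD1_ord t) //= => /eqP; rewrite addrC addr_eq0 => /eqP E.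
  have -> : v t = ratr (- (c t)^-1) * \sum_(i < n) ratr (c (lift t i)) * v (lift t i).
    rewrite E rmorphN /= fmorphV /= mulrN mulNr opprK mulKf //.
    by rewrite fmorph_eq0.
  apply: qspanZ; apply: qspan_sum => i _; apply: qspanZ.
  exact: (qspan_id (v \o lift t)).
have vu u : qspan (v \o lift t) (v u).
  have [<-//|ut] := eqVneq t u.
  have [i -> _] := unlift_some ut; exact: (qspan_id (v \o lift t)).
suff : (n.+1 <= n)%N by rewrite ltnn.
apply: nmin; apply/asboolP; exists (v \o lift t); split.
  apply/existsP; apply: contraT; rewrite negb_exists => /forallP z.
  have [e E] := vu t1; move: vt1; rewrite E big1 ?eqxx // => i _.
  by move: (z i); rewrite negbK => /eqP ->; rewrite mulr0.
by move=> x i xs; apply: qspan_trans (sv x (lift t i) xs).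
Qed.

(* Taking traces of multiplication matrices on a rational space stable under
   the radicals: an irrational positive radical has trace zero because its
   minimal polynomial is ['X^d - q] with [d > 1]. *)
Theorem real_radicals_free (k : nat) (s : seq R) (c : R -> rat) :
  (0 < k)%N -> uniq s ->
  (forall x, x \in s -> 0 < x /\ exists q : rat, x ^+ k = ratr q) ->
  (forall x y (q : rat), x \in s -> y \in s -> x = ratr q * y -> x = y) ->
  \sum_(x <- s) ratr (c x) * x = 0 -> forall x, x \in s -> c x = 0.
Proof.
move=> k0 us sP sI rel x0 x0s.
have [|n [w [fw [[t0 wt0] st]]]] := @exists_qstable_basis k s k0.
  by move=> x /sP[].
pose W : 'cV[R]_n.+1 := \col_i w i.
(* Since [w] is free, a rational matrix is determined by its action on [W], so identities between
   reals lift to matrices. *)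
have freeW (N : 'M[rat]_n.+1) : map_mx ratr N *m W = 0 -> N = 0.
  move=> /matrixP h; apply/matrixP => i j; rewrite mxE.
  apply: (fw (N i)); have := h i 0; rewrite !mxE => {2}<-.
  by apply: eq_bigr => t _; rewrite !mxE.
have mulW x : x \in s -> exists N : 'M[rat]_n.+1, map_mx ratr N *m W = x *: W.
  move=> xs; have /choice[f Ef] : forall i, exists e : 'I_n.+1 -> rat,
      x * w i = \sum_t ratr (e t) * w t by move=> i; exact: st.
  exists (\matrix_(i, j) f i j); apply/matrixP => i j; rewrite !mxE Ef.
  by apply: eq_bigr => t _; rewrite !mxE.
have /choice[N EN] : forall x, exists N : 'M[rat]_n.+1,
    x \in s -> map_mx ratr N *m W = x *: W.
  move=> x; case: (boolP (x \in s)) => [/mulW[N EN]|_]; first by exists N.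
  by exists 0.
have powW (M : 'M[rat]_n.+1) a e : map_mx ratr M *m W = a *: W ->
    map_mx ratr (M ^+ e) *m W = a ^+ e *: W.
  move=> EM; elim: e => [|e IH]; first by rewrite !expr0 map_mx1 mul1mx scale1r.
  by rewrite exprS map_mxM -mulmxA IH -scalemxAr EM scalerA -exprSr.
(* [a x] is [x / x0] times the rational [x0 ^+ k]: a division by [x0] written with products only. It
   is rational at [x0] and an irrational radical at the other elements. *)
pose M x := N x *m N x0 ^+ k.-1; pose a x := x * x0 ^+ k.-1.
have EM x : x \in s -> map_mx ratr (M x) *m W = a x *: W.
  move=> xs; rewrite map_mxM -mulmxA (powW _ x0) ?EN //.
  by rewrite -scalemxAr EN // scalerA mulrC.
have x0_gt0 : 0 < x0 by have [] := sP _ x0s.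
have [q0 Eq0] : exists q : rat, x0 ^+ k = ratr q by have [] := sP _ x0s.
have ax0 : a x0 = ratr q0 by rewrite /a -exprS prednK.
have relM : \sum_(x <- s) c x *: M x = 0.
  apply: freeW; rewrite raddf_sum mulmx_suml big_seq.
  rewrite (eq_bigr (fun x => (ratr (c x) * x * x0 ^+ k.-1) *: W)); last first.
    by move=> x xs; rewrite /= map_mxZ -scalemxAl EM // scalerA mulrA.
  by rewrite -big_seq -scaler_suml -mulr_suml rel mul0r scale0r.
have scalW (A : 'M[rat]_n.+1) q : map_mx ratr A *m W = ratr q *: W -> A = q%:M.
  move=> h; apply/eqP; rewrite -subr_eq0; apply/eqP/freeW.
  by rewrite map_mxB mulmxBl h map_scalar_mx mul_scalar_mx subrr.
have trM x : x \in s -> x != x0 -> \tr (M x) = 0.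
  move=> xs xx0; have [x_gt0 [qx Eqx]] := sP _ xs.
  have a_gt0 : 0 < a x by rewrite mulr_gt0 // exprn_gt0.
  have ex : exists d, (0 < d)%N && `[< exists q : rat, a x ^+ d = ratr q >].
    exists k; rewrite k0; apply/asboolP; exists (qx * q0 ^+ k.-1).
    by rewrite /a exprMn Eqx -exprM mulnC exprM Eq0 rmorphM rmorphXn.
  case: (ex_minnP ex) => d /andP[d0 /asboolP[q Eq]] dmin.
  apply: (@mxtrace_radical R q d (a x)) => //.
  (* [d = 1] would make [x / x0] rational, hence [x = x0] by [sI]. *)
  - rewrite ltn_neqAle d0 andbT eq_sym; apply/eqP => d1; move: Eq; rewrite d1 expr1.
    move=> Ea; case/eqP: xx0; apply: (sI _ _ (q / q0)) => //.
    have x0k : x0 ^+ k.-1 != 0 by rewrite expf_neq0 // gt_eqF.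
    apply: (mulIf x0k); rewrite -/(a x) Ea fmorph_div /= -mulrA -/(a x0) ax0 divfK //.
    by rewrite -Eq0 expf_neq0 // gt_eqF.
  - move=> e r /andP[e0 ed]; apply/eqP => Er; move: ed; rewrite ltnNge dmin //.
    by rewrite e0; apply/asboolP; exists r.
  - by apply: scalW; rewrite (powW _ (a x)) ?EM // Eq.
have : \sum_(x <- s) c x * \tr (M x) = 0.
  rewrite -[RHS](mxtrace0 rat n.+1) -relM raddf_sum; apply: eq_bigr => x _.
  by rewrite /= mxtraceZ.
rewrite (bigD1_seq x0) //= big1_seq ?addr0; last first.
  by move=> x /andP[xx0 xs]; rewrite trM ?mulr0.
rewrite (scalW (M x0) q0) ?EM ?ax0 // mxtrace_scalar => /eqP.
rewrite mulf_eq0 mulrn_eq0 /= => /orP[/eqP //|/eqP q00].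
by move: Eq0; rewrite q00 rmorph0 => /eqP; rewrite expf_eq0 k0 (gt_eqF x0_gt0).
Qed.

End RationalSpan.

(** * The set Lambda *)

Lemma logn_bigprod (I : eqType) (r : seq I) (F : I -> nat) p :
  (forall i, i \in r -> (0 < F i)%N) ->
  logn p (\prod_(i <- r) F i) = (\sum_(i <- r) logn p (F i))%N.
Proof.
elim: r => [|i r IH] F0; first by rewrite !big_nil logn1.
rewrite !big_cons lognM ?IH ?F0 ?mem_head // => [j jr|].
  by rewrite F0 // inE jr orbT.
rewrite big_seq; apply: prodn_cond_gt0 => j jr.
by rewrite F0 // inE jr orbT.
Qed.

(** The values [0] and [k + 1, ..., 2 k - 1] are pairwise incongruent modulo [k]. *)
Lemma eq_of_eq_mod_gap k u v s t : (s <= t)%N ->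
  (u == 0)%N || (k < u < k + k)%N -> (v == 0)%N || (k < v < k + k)%N ->
  (u + k * t = v + k * s)%N -> u = v.
Proof.
move=> /subnKC <-; rewrite mulnDr; case: (t - s)%N => [|[|e]]; rewrite ?mulnS; lia.
Qed.

Section Lambda.
Variables (R : realType) (k : nat).
Hypothesis k_ge2 : (2 <= k)%N.

(* The valuations of [b_1^(k+1) ... b_(k-1)^(2k-1)], for [b_1 ... b_(k-1)]
   squarefree, vanish or lie strictly between [k] and [2k]. *)
Definition reduced_radical (x : R) : Prop :=
  0 < x /\ exists m : nat, [/\ (0 < m)%N, x ^+ k = m%:R &
    forall p, (logn p m == 0)%N || (k < logn p m < k + k)%N].

Lemma reduced_radical1 : reduced_radical 1.
Proof. by split => //; exists 1%N; split; rewrite ?expr1n // => p; rewrite logn1. Qed.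

(** A rational factor changes every valuation of [x ^+ k] by a multiple of [k], and the allowed
    valuations are determined by their residues modulo [k]. *)
Lemma reduced_radical_ratio x y (q : rat) :
  reduced_radical x -> reduced_radical y -> x = ratr q * y -> x = y.
Proof.
have k0 : (0 < k)%N by exact: ltn_trans k_ge2.
move=> [x0 [m [m0 Em mP]]] [y0 [m' [m0' Em' mP']]] E.
have q0 : 0 < q by move: x0; rewrite E pmulr_lgt0 // ltr0q.
pose a := `|numq q|%N; pose b := `|denq q|%N.
have a0 : (0 < a)%N by rewrite absz_gt0 numq_eq0 gt_eqF.
have b0 : (0 < b)%N by rewrite absz_gt0 denq_neq0.
have Eq : ratr q = a%:R / b%:R :> R.
  rewrite /ratr /a /b; congr (_ / _).
    by rewrite -[in LHS](gez0_abs (m := numq q)) ?numq_ge0 ?ltW.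
  by rewrite -[in LHS](gez0_abs (m := denq q)) ?denq_ge0 ?ltW.
have Emm : (m * b ^ k = m' * a ^ k)%N.
  apply/eqP; rewrite -(eqr_nat R) !natrM !natrX -Em -Em' E Eq exprMn expr_div_n.
  apply/eqP; field; by rewrite expf_neq0 // pnatr_eq0 -lt0n.
have Emm' : m = m'.
  apply: eqn_from_log => // p.
  have := congr1 (logn p) Emm; rewrite !lognM ?expn_gt0 ?a0 ?b0 // !lognX.
  by case/orP: (leq_total (logn p a) (logn p b)) => h E1;
    [|symmetry]; apply: (eq_of_eq_mod_gap h) => //.
apply/eqP; rewrite -(@eqrXn2 _ k) ?(ltW x0) ?(ltW y0) // Em Em' Emm' //.
Qed.

Lemma inLambda_radical (b : nat -> nat) (l : R) :
  l = ((\prod_(1 <= i < k) b i ^ (k + i))%N%:R) `^ (k%:R^-1) ->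
  l ^+ k = (\prod_(1 <= i < k) b i ^ (k + i))%N%:R.
Proof.
move=> ->; rewrite -powR_mulrn ?powR_ge0 // -powRrM mulVf ?powRr1 //.
by rewrite pnatr_eq0 -lt0n (ltn_trans _ k_ge2).
Qed.

Lemma leq_prod_weights (b : nat -> nat) :
  (forall i : nat, (1 <= i < k)%N -> (0 < b i)%N) ->
  ((\prod_(1 <= i < k) b i) ^ k.+1 <= \prod_(1 <= i < k) b i ^ (k + i))%N.
Proof.
move=> b0; rewrite (big_morph (expn^~ k.+1) (fun x y => expnMn x y _) (exp1n _)).
rewrite !big_nat; apply: leq_prod => i /andP[i0 ik].
by rewrite leq_pexp2l ?b0 ?i0 // -addn1 leq_add2l.
Qed.

Lemma inLambda_reduced (l : R) : inLambda k l -> reduced_radical l.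
Proof.
move=> [b [b0 [b2 [bsf El]]]].
have Elk := inLambda_radical El.
have m0 : (0 < \prod_(1 <= i < k) b i ^ (k + i))%N.
  rewrite big_nat; apply: prodn_cond_gt0 => i ik; by rewrite expn_gt0 b0.
split; first by rewrite El powR_gt0 // ltr0n.
exists (\prod_(1 <= i < k) b i ^ (k + i))%N; split => // p.
have [pp|npp] := boolP (prime p); last by rewrite lognE (negPf npp).
have Es : (logn p (\prod_(1 <= i < k) b i) = \sum_(1 <= i < k) logn p (b i))%N.
  by apply: logn_bigprod => i; rewrite mem_index_iota; exact: b0.
have Em : (logn p (\prod_(1 <= i < k) b i ^ (k + i)) =
           \sum_(1 <= i < k) (k + i) * logn p (b i))%N.
  rewrite logn_bigprod => [|i]; last by rewrite mem_index_iota expn_gt0 => ik; rewrite b0.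
  by apply: eq_bigr => i _; rewrite lognX.
have s1 : (\sum_(1 <= i < k) logn p (b i) <= 1)%N.
  rewrite leqNgt -Es -pfactor_dvdn ?expnS ?expn0 ?muln1; first exact: bsf.
  - by [].
  - by rewrite (ltn_trans _ b2).
(* A prime divides at most one [b i], and only once. Bounding all weights by [k.+1] and [(k + k).-1]
   avoids locating that index [i]. *)
have lo : (k.+1 * \sum_(1 <= i < k) logn p (b i) <=
           \sum_(1 <= i < k) (k + i) * logn p (b i))%N.
  rewrite big_distrr /= big_nat [leqRHS]big_nat; apply: leq_sum => i /andP[i1 _].
  by rewrite leq_mul2r -addn1 leq_add2l i1 orbT.
have hi : (\sum_(1 <= i < k) (k + i) * logn p (b i) <=
           (k + k).-1 * \sum_(1 <= i < k) logn p (b i))%N.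
  rewrite big_distrr /= big_nat [leqRHS]big_nat; apply: leq_sum => i /andP[_ ik].
  by rewrite leq_mul2r; apply/orP; right; move: ik; clear; lia.
rewrite Em; move: lo hi s1 k_ge2; clear.
move: (\sum_(1 <= i < k) logn p (b i))%N (\sum_(1 <= i < k) (k + i) * logn p (b i))%N => u v.
case: u => [|[|]] //; first by rewrite !muln0 leqn0 => _ ->.
by rewrite !muln1 => lo hi _ k2; lia.
Qed.

(** All weights are at least [k.+1] and the product of the [b i] is at least 2, so
    [l ^+ k >= 2 ^ k.+1]. *)
Lemma inLambda_gt2 (l : R) : inLambda k l -> 2 < l.
Proof.
move=> Ll; have [l0 _] := inLambda_reduced Ll.
case: Ll => [b [b0 [b2 [_ El]]]]; have Elk := inLambda_radical El.
rewrite -(@ltr_pXn2r _ k) ?nnegrE ?(ltW l0) ?(ltn_trans _ k_ge2) //.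
rewrite Elk -natrX ltr_nat; apply: (leq_trans _ (leq_prod_weights b0)).
by apply: (@leq_trans (2 ^ k.+1)%N); rewrite ?ltn_exp2l ?leq_exp2r.
Qed.

End Lambda.

(** Meant for [k]-th roots [x], [y] of consecutive integers, where it compares the terms of zeta at
    [1 + 1 / k] with telescoping ones. It follows from the mean value bound
    [1 <= (y - x) * k * y ^+ k.-1]. *)
Lemma inv_expS_le_telescope (R : realFieldType) k (x y : R) :
  0 < x -> x <= y -> y ^+ k - x ^+ k = 1 -> y ^- k.+1 <= k%:R * (x^-1 - y^-1).
Proof.
move=> x0 xy E; have y0 : 0 < y by exact: lt_le_trans xy.
case: k E => [|k E]; first by rewrite !expr0 subrr => /eqP; rewrite eq_sym oner_eq0.
have h : 1 <= (y - x) * (k.+1%:R * y ^+ k).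
  rewrite -[leLHS]E subrXX ler_wpM2l ?subr_ge0 //.
  have -> : k.+1%:R * y ^+ k = \sum_(i < k.+1) y ^+ k.
    by rewrite sumr_const card_ord mulr_natl.
  apply: ler_sum => i _; have ik : (i <= k)%N by rewrite -ltnS.
  rewrite -[in leRHS](subnK ik) [in leRHS]exprD ler_wpM2l ?exprn_ge0 ?(ltW y0) //.
  by rewrite lerXn2r ?nnegrE ?(ltW x0) ?(ltW y0).
rewrite -subr_ge0.
have -> : k.+1%:R * (x^-1 - y^-1) - y ^- k.+2 =
    (y * ((y - x) * (k.+1%:R * y ^+ k)) - x) / (x * y ^+ k.+2).
  rewrite 2!(exprS y); field; by rewrite ?expf_neq0 ?gt_eqF.
apply: divr_ge0; last by rewrite mulr_ge0 ?exprn_ge0 ?(ltW x0) ?(ltW y0).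
rewrite subr_ge0.
by apply: (le_trans xy); rewrite ler_peMr // ltW.
Qed.

(** * Convergence of the sum of inverses over Lambda *)

Section LambdaSum.
Variables (R : realType) (k : nat).
Hypothesis k_ge2 : (2 <= k)%N.

Local Notation u b := ((b.+1%:R : R) `^ (k%:R^-1)).

Let k_gt0 : (0 < k)%N. Proof. exact: ltn_trans k_ge2. Qed.

Lemma root_natS_gt0 b : 0 < u b.
Proof. by rewrite powR_gt0. Qed.

Lemma root_natS_expr b : u b ^+ k = b.+1%:R.
Proof.
rewrite -powR_mulrn ?powR_ge0 // -powRrM mulVf ?powRr1 //.
by rewrite pnatr_eq0 -lt0n.
Qed.

Lemma zeta_partial_le n : \sum_(b < n) u b ^- k.+1 <= k.+1%:R.
Proof.
case: n => [|n]; first by rewrite big_ord0.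
suff : \sum_(b < n.+1) u b ^- k.+1 <= 1 + k%:R * (1 - (u n)^-1).
  move=> /le_trans; apply; rewrite -[leRHS]natr1 [leRHS]addrC lerD2l.
  by rewrite ler_piMr // gerBl invr_ge0 powR_ge0.
elim: n => [|n IH].
  by rewrite big_ord_recl big_ord0 powR1 !(expr1n, invr1, addr0, subrr, mulr0).
rewrite big_ord_recr /=; apply: (le_trans (lerD IH (inv_expS_le_telescope (root_natS_gt0 n) _ _))).
- rewrite ge0_ler_powR ?nnegrE ?ler_nat ?invr_ge0 //.
- by rewrite !root_natS_expr -[n.+2]addn1 natrD addrAC subrr add0r.
- by lra.
Qed.

Lemma inv_Lambda_le (b : nat -> nat) (l : R) :
  (forall i : nat, (1 <= i < k)%N -> (0 < b i)%N) ->
  l = ((\prod_(1 <= i < k) b i ^ (k + i))%N%:R) `^ (k%:R^-1) ->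
  l^-1 <= \prod_(i < k.-1) u (b i.+1).-1 ^- k.+1.
Proof.
move=> b0 El.
have p0 : 0 < \prod_(i < k.-1) u (b i.+1).-1 ^+ k.+1.
  by apply: prodr_gt0 => i _; rewrite exprn_gt0 ?root_natS_gt0.
have l0 : 0 < l.
  rewrite El powR_gt0 // ltr0n big_nat; apply: prodn_cond_gt0 => i ik.
  by rewrite expn_gt0 b0.
rewrite -(big_morph (@GRing.inv R) (fun x y => invfM x y) (invr1 _)).
rewrite lef_pV2 ?posrE // -(@ler_pXn2r _ k) ?nnegrE ?(ltW p0) ?(ltW l0) //.
rewrite (inLambda_radical k_ge2 El).
apply: le_trans (_ : ((\prod_(1 <= i < k) b i) ^ k.+1)%N%:R <= _).
  rewrite natrX natr_prod big_add1 big_mkord -!prodrXl ler_prod // => i _.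
  rewrite !exprn_ge0 ?powR_ge0 //= -exprM mulnC exprM root_natS_expr.
  by rewrite prednK ?lexx // b0 //= -ltn_predRL ltn_ord.
by rewrite ler_nat leq_prod_weights.
Qed.

(** Expanding a product of [k.-1] zeta sums, each at most [k.+1], gives one term for each tuple
    [b_1, ..., b_(k-1)]; distinct elements come from distinct tuples. *)
Lemma Lambda_sum_le (s : seq R) : uniq s -> (forall l, l \in s -> inLambda k l) ->
  \sum_(l <- s) l^-1 <= k.+1%:R ^+ k.-1.
Proof.
move=> us sL.
have /choice[b bP] : forall l : R, exists b : nat -> nat, inLambda k l ->
    (forall i : nat, (1 <= i < k)%N -> (0 < b i)%N) /\
    l = ((\prod_(1 <= i < k) b i ^ (k + i))%N%:R) `^ (k%:R^-1).
  move=> l; have [[b [b0 [_ [_ El]]]]|nL] := pselect (inLambda k l); last by exists id.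
  by exists b.
pose B := (\max_(l <- s) \max_(i < k) b l i)%N.
have bB l (i : 'I_k.-1) : l \in s -> ((b l i.+1).-1 < B.+1)%N.
  move=> ls; rewrite ltnS (leq_trans (leq_pred _)) //.
  have ik : (i.+1 < k)%N by rewrite -ltn_predRL.
  apply: leq_trans (leq_bigmax_seq _ ls isT).
  exact: (leq_bigmax (Ordinal ik)).
pose phi l : {ffun 'I_k.-1 -> 'I_B.+1} := [ffun i => inord (b l (nat_of_ord i).+1).-1].
pose G (f : {ffun 'I_k.-1 -> 'I_B.+1}) : R := \prod_i u (f i) ^- k.+1.
have G0 f : 0 <= G f by apply: prodr_ge0 => i _; rewrite invr_ge0 exprn_ge0 ?powR_ge0.
have inj : {in s &, injective phi}.
  move=> l l' ls ls' /ffunP E; have [b0 ->] := bP l (sL _ ls); have [b0' ->] := bP l' (sL _ ls').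
  congr ((_%:R) `^ _); rewrite !big_add1 !big_mkord; apply: eq_bigr => i _; congr (_ ^ _)%N.
  have := congr1 val (E i); rewrite !ffunE /= !inordK ?bB //.
  have i1 : (1 <= i.+1 < k)%N by rewrite /= -ltn_predRL.
  by move: (b0 _ i1) (b0' _ i1); case: (b l _) => // n; case: (b l' _) => // m _ _ /= ->.
apply: (@le_trans _ _ (\sum_(f <- map phi s) G f)).
  rewrite big_map big_seq [leRHS]big_seq; apply: ler_sum => l ls.
  have [b0 El] := bP l (sL _ ls); apply: (le_trans (inv_Lambda_le b0 El)).
  by rewrite le_eqVlt; apply/orP; left; apply/eqP/eq_bigr => i _; rewrite ffunE inordK ?bB.
rewrite big_uniq ?map_inj_in_uniq //=.
apply: (@le_trans _ _ (\sum_f G f)).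
  by rewrite [leRHS](bigID (mem (map phi s))) /= lerDl sumr_ge0.
rewrite /G -(bigA_distr_bigA (fun (i : 'I_k.-1) (j : 'I_B.+1) => u j ^- k.+1)).
rewrite prodr_const card_ord lerXn2r ?nnegrE ?zeta_partial_le //.
by apply: sumr_ge0 => i _; rewrite invr_ge0 exprn_ge0 ?powR_ge0.
Qed.

Lemma Lambda_sum_tail (e : R) : 0 < e -> exists X : R, forall s : seq R, uniq s ->
  (forall l, l \in s -> inLambda k l /\ X < l) -> \sum_(l <- s) l^-1 <= e.
Proof.
move=> e0.
pose A : set R := [set x | exists s : seq R, [/\ uniq s, forall l, l \in s -> inLambda k l &
  x = \sum_(l <- s) l^-1]]%classic.
have ubA : has_ubound A.
  by exists (k.+1%:R ^+ k.-1) => _ [s [us sL ->]]; exact: Lambda_sum_le.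
have supA : has_sup A by split=> //; exists 0; exists [::]; rewrite big_nil.
have [_ [s0 [us0 s0L ->]] hs0] := sup_adherent e0 supA.
(* An element above the sum of [s0] lies outside [s0]. So [s ++ s0] is duplicate free, its sum is at
   most the supremum, and [s0] alone misses the supremum by less than [e]. *)
exists (\sum_(l <- s0) l) => s us sL.
have sL' l : l \in s -> inLambda k l by move=> /sL[].
have l0 l : inLambda k l -> 0 < l by move=> /(inLambda_gt2 k_ge2); exact: lt_trans.
have dis : uniq (s ++ s0).
  rewrite cat_uniq us us0 andbT; apply/hasPn => l ls0; apply/negP => /= ls.
  have [_] := sL _ ls; rewrite (bigD1_seq l) //= ltNge lerDl; apply/negP.
  rewrite negbK big_seq_cond; apply: sumr_ge0 => i /andP[is0 _].
  exact/ltW/l0/s0L.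
have : \sum_(l <- s ++ s0) l^-1 <= sup A.
  apply: ub_le_sup => //; exists (s ++ s0); split => // l.
  by rewrite mem_cat => /orP[/sL'|/s0L].
by rewrite big_cat /=; move: hs0; lra.
Qed.

End LambdaSum.

(** * Mean values *)

Section Means.
Variable R : realType.
Implicit Types (u v : nat -> R) (l e : R).

Definition has_mean u l : Prop := forall e, 0 < e -> exists N0 : nat,
  forall N, (N0 <= N)%N -> `|\sum_(n < N) u n - l * N%:R| <= e * N%:R.

(** An eventual bound on the mean of [|u - v|], in the manner of the Besicovitch seminorm. *)
Definition mean_close u v e : Prop := exists N0 : nat,
  forall N, (N0 <= N)%N -> \sum_(n < N) `|u n - v n| <= e * N%:R.

Lemma has_mean_cst l : has_mean (fun=> l) l.
Proof.
move=> e e0; exists 0%N => N _.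
by rewrite sumr_const card_ord mulr_natr subrr normr0 mulr_ge0 // ltW.
Qed.

Lemma has_meanD u v l m : has_mean u l -> has_mean v m ->
  has_mean (fun n => u n + v n) (l + m).
Proof.
move=> hu hv e e0; have e2 : 0 < e / 2 by rewrite divr_gt0.
have [N1 h1] := hu _ e2; have [N2 h2] := hv _ e2; exists (maxn N1 N2) => N.
rewrite geq_max => /andP[/h1 a /h2 b]; rewrite big_split /=.
have -> : \sum_(i < N) u i + \sum_(i < N) v i - (l + m) * N%:R =
  (\sum_(i < N) u i - l * N%:R) + (\sum_(i < N) v i - m * N%:R) by ring.
by apply: (le_trans (ler_normD _ _)); lra.
Qed.

Lemma has_meanZ c u l : has_mean u l -> has_mean (fun n => c * u n) (c * l).
Proof.
move=> hu e e0; have c0 : 0 < `|c| + 1 by rewrite ltr_wpDl.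
have [N0 h] := hu _ (divr_gt0 e0 c0); exists N0 => N /h hN.
rewrite -mulr_sumr -mulrA -mulrBr normrM.
apply: (@le_trans _ _ ((`|c| + 1) * `|\sum_(n < N) u n - l * N%:R|)).
  by rewrite ler_wpM2r // lerDl.
by rewrite mulrC -ler_pdivlMr // mulrAC.
Qed.

Lemma has_mean_close u l :
  (forall e, 0 < e -> exists v m, [/\ has_mean v m, `|m - l| <= e & mean_close u v e]) ->
  has_mean u l.
Proof.
move=> h e e0; have e3 : 0 < e / 3 by rewrite divr_gt0.
have [v [m [hv ml [N1 h1]]]] := h _ e3; have [N2 h2] := hv _ e3.
exists (maxn N1 N2) => N; rewrite geq_max => /andP[/h1 a /h2 b].
have -> : \sum_(i < N) u i - l * N%:R =
  \sum_(i < N) (u i - v i) + (\sum_(i < N) v i - m * N%:R) + (m - l) * N%:R.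
  by rewrite big_split /= sumrN; ring.
have c : `|\sum_(i < N) (u i - v i)| <= \sum_(i < N) `|u i - v i| by exact: ler_norm_sum.
have d : `|(m - l) * N%:R| <= e / 3 * N%:R by rewrite normrM normr_nat ler_wpM2r.
apply: (le_trans (ler_normD _ _)); apply: (le_trans (lerD (ler_normD _ _) (lexx _))).
by have := le_trans c a; lra.
Qed.

Lemma mean_closeD u v u' v' e e' : mean_close u v e -> mean_close u' v' e' ->
  mean_close (fun n => u n + u' n) (fun n => v n + v' n) (e + e').
Proof.
move=> [N1 h1] [N2 h2]; exists (maxn N1 N2) => N.
rewrite geq_max => /andP[/h1 a /h2 b]; rewrite mulrDl.
apply: le_trans (lerD a b); rewrite -big_split; apply: ler_sum => i _.
by rewrite opprD addrACA ler_normD.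
Qed.

Lemma mean_closeN u v e : mean_close u v e ->
  mean_close (fun n => - u n) (fun n => - v n) e.
Proof.
move=> [N1 h1]; exists N1 => N /h1; apply: le_trans; apply: ler_sum => i _.
by rewrite -opprD normrN.
Qed.

Lemma mean_close_refl u e : 0 < e -> mean_close u u e.
Proof.
move=> e0; exists 0%N => N _; rewrite big1 ?mulr_ge0 ?(ltW e0) // => i _.
by rewrite subrr normr0.
Qed.

(** The shifted sum involves [N.+1] terms, and [e * N.+1%:R <= (e + e) * N%:R] once [N] is
    positive. *)
Lemma mean_close_shift u v e : 0 < e -> mean_close u v e ->
  mean_close (fun n => u n.+1) (fun n => v n.+1) (e + e).
Proof.
move=> e0 [N1 h1]; exists N1.+1 => N hN.
have /h1 : (N1 <= N.+1)%N by exact: (leq_trans (ltnW hN) (leqnSn _)).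
rewrite big_ord_recl => a.
have a' : \sum_(i < N) `|u i.+1 - v i.+1| <= e * N.+1%:R.
  by apply: le_trans a; rewrite lerDr.
apply: (le_trans a'); rewrite -natr1 mulrDr mulr1 mulrDl lerD2l.
by rewrite ler_peMr ?(ltW e0) // ler1n (leq_trans _ hN).
Qed.

End Means.

(** * Cosine waves and their means *)

Section Waves.
Variable R : realType.
Implicit Types (b p x w : R).

Definition wave b p (n : nat) : R := cos (pi *+ 2 * (b * n%:R) + p).

Lemma wave_norm_le1 b p n : `|wave b p n| <= 1.
Proof. exact: cos_max. Qed.

Lemma wave0 p n : wave 0 p n = cos p.
Proof. by rewrite /wave mul0r mulr0 add0r. Qed.

Lemma waveM b p b' p' n :
  wave b p n * wave b' p' n = (wave (b + b') (p + p') n + wave (b - b') (p - p') n) / 2.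
Proof.
rewrite /wave.
have -> : pi *+ 2 * ((b + b') * n%:R) + (p + p') =
  (pi *+ 2 * (b * n%:R) + p) + (pi *+ 2 * (b' * n%:R) + p') :> R by ring.
have -> : pi *+ 2 * ((b - b') * n%:R) + (p - p') =
  (pi *+ 2 * (b * n%:R) + p) - (pi *+ 2 * (b' * n%:R) + p') :> R by ring.
set A := _ + p; set B := _ + p'.
by rewrite (cosD A B) (cosB A B); field.
Qed.

Lemma cosD2pi_int x (z : int) : cos (x + pi *+ 2 * z%:~R) = cos x.
Proof.
have nat_case (y : R) (n : nat) : cos (y + pi *+ 2 * n%:R) = cos y.
  elim: n => [|n IH]; first by rewrite mulr0 addr0.
  by rewrite -natr1 mulrDr mulr1 addrA cosD2pi.
case: z => n; first exact: nat_case.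
rewrite NegzE mulrNz -[LHS](nat_case _ n.+1); congr cos.
by rewrite -pmulrn; ring.
Qed.

Lemma sum_cos w p N : 2 * sin (w / 2) * \sum_(n < N) cos (w * n%:R + p) =
  sin (w * N%:R - w / 2 + p) - sin (- (w / 2) + p).
Proof.
elim: N => [|N IH]; first by rewrite big_ord0 !mulr0 add0r subrr.
rewrite big_ord_recr /= mulrDr IH.
have -> : w * N.+1%:R - w / 2 + p = (w * N%:R + p) + w / 2.
  by rewrite -natr1; field.
have -> : w * N%:R - w / 2 + p = (w * N%:R + p) - w / 2 by ring.
set A := w * N%:R + p.
by rewrite (sinB A) (sinD A); ring.
Qed.

Lemma sin_pi_int_neq0 b : (forall z : int, b != z%:~R) -> sin (pi * b) != 0.
Proof.
move=> hb; apply/negP => /eqP s0.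
pose f := Num.floor b; pose y := b - f%:~R.
have y0 : 0 < y by rewrite subr_gt0 lt_neqAle eq_sym hb ge_floor.
have y1 : y < 1 by rewrite ltrBlDl -intrD1 lt_succ_floor.
have : cos (pi *+ 2 * b) = 1.
  rewrite (_ : pi *+ 2 * b = (pi * b) *+ 2); last by rewrite mulrnAl.
  by rewrite cos_mulr2n cos2sin2 s0 expr0n /= subr0; ring.
have -> : pi *+ 2 * b = pi *+ 2 * y + pi *+ 2 * f%:~R by rewrite /y; ring.
rewrite cosD2pi_int (_ : pi *+ 2 * y = (pi * y) *+ 2); last by rewrite mulrnAl.
rewrite cos_mulr2n cos2sin2 => E.
have : 0 < sin (pi * y).
  by apply: sin_gt0_pi; rewrite mulr_gt0 ?pi_gt0 //= gtr_pMr ?pi_gt0.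
by move: E; nra.
Qed.

(** By [sum_cos] the partial sums are bounded by [1 / |sin (pi * b)|], uniformly in [N]. *)
Lemma wave_mean0 b p : (forall z : int, b != z%:~R) -> has_mean (wave b p) 0.
Proof.
move=> hb e e0; have s0 := sin_pi_int_neq0 hb.
have se : 0 < `|sin (pi * b)| * e by rewrite mulr_gt0 // normr_gt0.
exists (Num.truncn ((`|sin (pi * b)| * e)^-1)).+1 => N hN.
rewrite mul0r subr0.
have hw : pi *+ 2 * b / 2 = pi * b by field.
have := sum_cos (pi *+ 2 * b) p N; rewrite hw => E.
have E2 : 2 * `|sin (pi * b)| * `|\sum_(n < N) wave b p n| <= 2.
  rewrite -[X in X * _ * _](normr_nat _ 2) -!normrM.
  under eq_bigr do rewrite /wave mulrA.
  rewrite E; apply: (le_trans (ler_normB _ _)).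
  by have := sin_max (pi *+ 2 * b * N%:R - pi * b + p); have := sin_max (- (pi * b) + p); lra.
have h1 : (`|sin (pi * b)| * e)^-1 <= N%:R.
  by apply: le_trans (ltW (truncnS_gt _)) _; rewrite ler_nat.
have sp : 0 < `|sin (pi * b)| by rewrite normr_gt0.
have h2 : 1 <= `|sin (pi * b)| * (e * N%:R).
  by rewrite mulrA -ler_pdivrMl // mulr1.
by rewrite -(ler_pM2l sp); lra.
Qed.

End Waves.

(** * The Fejer kernel *)

Section TrigPoly.
Variables (R : realType) (th : R).

(* The second index is the coefficient of the zero frequency. *)
Inductive trigpoly : (nat -> R) -> R -> Prop :=
| trigpoly_wave c (h : int) p :
    trigpoly (fun n => c * wave (h%:~R * th) p n) (if h == 0 then c * cos p else 0)
| trigpolyD u v a b : trigpoly u a -> trigpoly v b ->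
    trigpoly (fun n => u n + v n) (a + b).

Lemma trigpoly_eq u v a b : trigpoly u a -> u =1 v -> a = b -> trigpoly v b.
Proof. by move=> tu /funext <- <-. Qed.

Lemma trigpoly_cst a : trigpoly (fun=> a) a.
Proof.
apply: trigpoly_eq (trigpoly_wave a 0 0) _ _ => [n|] /=.
  by rewrite mul0r wave0 cos0 mulr1.
by rewrite cos0 mulr1.
Qed.

Lemma trigpolyZ c u a : trigpoly u a -> trigpoly (fun n => c * u n) (c * a).
Proof.
elim=> {u a} [d h p|u v a b _ IHu _ IHv].
  apply: trigpoly_eq (trigpoly_wave (c * d) h p) _ _ => [n|]; first by rewrite mulrA.
  by case: ifP => _; rewrite ?mulr0 // mulrA.
by apply: trigpoly_eq (trigpolyD IHu IHv) _ _ => [n|] /=; rewrite mulrDr.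
Qed.

Lemma trigpoly_sum (T : finType) (u : T -> nat -> R) a :
  (forall i, trigpoly (u i) (a i)) -> trigpoly (fun n => \sum_i u i n) (\sum_i a i).
Proof.
move=> h; rewrite -big_enum /=.
have -> : (fun n => \sum_i u i n) = fun n => \sum_(i <- enum T) u i n.
  by apply/funext => n; rewrite big_enum.
elim: (enum T) => [|i s IH].
  by apply: trigpoly_eq (trigpoly_cst 0) _ _ => [n|]; rewrite big_nil.
apply: trigpoly_eq (trigpolyD (h i) IH) _ _ => [n|]; by rewrite big_cons.
Qed.

(** A shift changes phases only, and at the zero frequency not even the phase. *)
Lemma trigpoly_shift u a : trigpoly u a -> trigpoly (fun n => u n.+1) a.
Proof.
elim=> {u a} [d h p|u v a b _ IHu _ IHv]; last exact: trigpolyD.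
apply: trigpoly_eq (trigpoly_wave d h (pi *+ 2 * (h%:~R * th) + p)) _ _ => [n|].
  by congr (_ * cos _); rewrite -natr1; ring.
by case: eqP => // ->; rewrite mul0r mulr0 add0r.
Qed.

Hypothesis th_irr : forall h z : int, h != 0 -> h%:~R * th != z%:~R.

Lemma trigpoly_mean u a : trigpoly u a -> has_mean u a.
Proof.
elim=> {u a} [d h p|u v a b _ IHu _ IHv]; last exact: has_meanD.
have [->|h0] := eqVneq h 0.
  have -> : (fun n => d * wave (0%:~R * th) p n) = fun=> d * cos p.
    by apply/funext => n; rewrite mul0r wave0.
  exact: has_mean_cst.
by rewrite -(mulr0 d); apply/has_meanZ/wave_mean0 => z; exact: th_irr.
Qed.

End TrigPoly.

Section Fejer.
Variable R : realType.
Implicit Types (x y : R) (L : nat).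

(** The squared modulus of the sum of [exp (2 pi i j x)] over [j < L], that is [L] times the usual
    Fejer kernel. *)
Definition fejer L x : R := \sum_(j < L) \sum_(i < L) cos (pi *+ 2 * ((j%:R - i%:R) * x)).

Lemma fejerE L x : fejer L x =
  (\sum_(j < L) cos (pi *+ 2 * x * j%:R)) ^+ 2 + (\sum_(j < L) sin (pi *+ 2 * x * j%:R)) ^+ 2.
Proof.
rewrite !expr2 !mulr_suml -big_split; apply: eq_bigr => j _ /=.
rewrite !mulr_sumr -big_split; apply: eq_bigr => i _ /=.
by rewrite -cosB; congr cos; ring.
Qed.

Lemma fejer_ge0 L x : 0 <= fejer L x.
Proof. by rewrite fejerE addr_ge0 ?sqr_ge0. Qed.

Lemma fejer_periodic L x (z : int) : fejer L (x + z%:~R) = fejer L x.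
Proof.
apply: eq_bigr => j _; apply: eq_bigr => i _.
rewrite -[RHS](cosD2pi_int _ ((j%:Z - i%:Z) * z)); congr cos.
by rewrite intrM intrB -!pmulrn; ring.
Qed.

(** After multiplication by [sin (pi * x)], the cosine sum and the sine sum are each at most 1 in
    absolute value; the sine sum is a cosine sum with phase [- (pi / 2)]. *)
Lemma fejer_le L x : sin (pi * x) ^+ 2 * fejer L x <= 2.
Proof.
have hw : pi *+ 2 * x / 2 = pi * x by field.
have half p : `|sin (pi * x) * \sum_(j < L) cos (pi *+ 2 * x * j%:R + p)| <= 1.
  have := sum_cos (pi *+ 2 * x) p L; rewrite hw -mulrA => E.
  have : `|2 * (sin (pi * x) * \sum_(n < L) cos (pi *+ 2 * x * n%:R + p))| <= 2.
    rewrite E; apply: (le_trans (ler_normB _ _)).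
    by have := sin_max (pi *+ 2 * x * L%:R - pi * x + p);
       have := sin_max (- (pi * x) + p); lra.
  by rewrite normrM normr_nat; lra.
have hc := half 0; have hs := half (- (pi / 2)).
have sq y : `|y| <= 1 -> y ^+ 2 <= 1 by move=> y1; rewrite -real_normK ?num_real // expr_le1.
move: (sq _ hc) (sq _ hs); rewrite !exprMn => c s.
rewrite fejerE mulrDr.
under eq_bigr do rewrite -[X in cos X]addr0.
under [X in _ + _ * X ^+ 2]eq_bigr do rewrite -cosBpihalf.
lra.
Qed.

(** Summing over the grid kills every frequency [j - i] that is not a multiple of [L]; the [L]
    diagonal terms contribute [L] each. The grid thus replaces the integral in the convolution. *)
Lemma fejer_grid_sum L x : \sum_(r < L) fejer L (x - r%:R / L%:R) = L%:R ^+ 2.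
Proof.
case: L => [|L]; first by rewrite big_ord0 expr0n.
have L0 : (L.+1%:R : R) != 0 by rewrite pnatr_eq0.
rewrite exchange_big /=.
transitivity (\sum_(j < L.+1) (L.+1%:R : R)); last first.
  by rewrite sumr_const card_ord expr2 mulr_natr.
apply: eq_bigr => j _; rewrite exchange_big /= (bigD1 j) //= [X in _ + X]big1 ?addr0.
  under eq_bigr do rewrite subrr mul0r mulr0 cos0.
  by rewrite sumr_const card_ord.
move=> i ij; pose h : int := j%:Z - i%:Z.
have Eh : (j%:R - i%:R : R) = h%:~R by rewrite intrB -!pmulrn.
have h0 : h != 0 by rewrite subr_eq0 eqz_nat eq_sym.
pose w : R := - (pi *+ 2 * h%:~R / L.+1%:R).
have := sum_cos w (pi *+ 2 * (h%:~R * x)) L.+1.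
(* Across the grid the argument advances by whole turns, so the telescoped sum vanishes, whereas
   [sin (w / 2)] does not because [0 < |h| < L.+1]. *)
have -> : w * L.+1%:R - w / 2 + pi *+ 2 * (h%:~R * x) =
    - (w / 2) + pi *+ 2 * (h%:~R * x) + pi *+ 2 * (- h)%:~R.
  by rewrite intrN /w; field.
have -> (y : R) (z : int) : sin (y + pi *+ 2 * z%:~R) = sin y.
  by rewrite -!cosBpihalf addrAC cosD2pi_int.
rewrite subrr => /eqP; rewrite !mulf_eq0 pnatr_eq0 /= => /orP[s0|/eqP E0].
  exfalso; move: s0; apply/negP.
  have -> : w / 2 = - (pi * (h%:~R / L.+1%:R)) by rewrite /w; field.
  rewrite sinN oppr_eq0; apply: sin_pi_int_neq0 => z; apply/eqP => Ez.
  have {Ez} : (h = z * L.+1%:Z)%R.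
    by apply/eqP; rewrite -(eqr_int R) intrM -Ez pmulrn divfK.
  have := ltn_ord j; have := ltn_ord i; move: h0; rewrite /h.
  move: (nat_of_ord i) (nat_of_ord j) => a b; clear => ab bL aL Eab.
  have [z1|[z0|z1]] : (z >= 1)%R \/ z = 0 \/ (z <= -1)%R by lia.
  - by nia.
  - by move: ab; rewrite Eab z0 mul0r eqxx.
  - by nia.
rewrite -[RHS]E0; apply: eq_bigr => r _; congr cos; rewrite Eh /w; field; by rewrite nat1r.
Qed.

Lemma cos_ge_half x : `|x| <= pi / 4 -> 2^-1 <= cos x.
Proof.
rewrite ler_norml => /andP[lo hi]; have p0 := pi_gt0 R.
have c0 : 0 <= cos x by apply: cos_ge0_pihalf; apply/andP; split; lra.
have : 0 <= cos (x *+ 2) by apply: cos_ge0_pihalf; rewrite -mulr_natr; apply/andP; split; lra.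
rewrite cos_mulr2n; have := cos_le1 x; nra.
Qed.

(** The constant 8 keeps every angle [2 pi (j - i) x] within [pi / 4], where the cosine is at least
    one half. *)
Lemma fejer_near0 L x : `|x| <= (8 * L%:R)^-1 -> L%:R ^+ 2 / 2 <= fejer L x.
Proof.
case: L => [_|L hx]; first by rewrite /fejer big_ord0 expr0n /= mul0r.
have E (a : R) : \sum_(i < L.+1) a = L.+1%:R * a by rewrite sumr_const card_ord mulr_natl.
have -> : (L.+1%:R : R) ^+ 2 / 2 = \sum_(j < L.+1) \sum_(i < L.+1) 2^-1 by rewrite !E; ring.
apply: ler_sum => j _; apply: ler_sum => i _; apply: cos_ge_half.
have ji : `|j%:R - i%:R : R| <= L.+1%:R.
  rewrite ler_norml; have : (j%:R : R) <= L.+1%:R by rewrite ler_nat ltnW.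
  have : (i%:R : R) <= L.+1%:R by rewrite ler_nat ltnW.
  have : (0 : R) <= j%:R by []. have : (0 : R) <= i%:R by [].
  by move=> *; apply/andP; split; lra.
have p2 : 0 <= pi *+ 2 :> R by have := pi_ge0 R; lra.
rewrite !normrM (ger0_norm p2).
have : `|j%:R - i%:R : R| * `|x| <= 8^-1.
  apply: (le_trans (ler_pM _ _ ji hx)) => //; rewrite le_eqVlt; apply/orP; left; apply/eqP.
  by field; rewrite nat1r pnatr_eq0.
have := pi_gt0 R; nra.
Qed.

Lemma fejer_trigpoly L (th y : R) : trigpoly th (fun n => fejer L (n%:R * th + y)) L%:R.
Proof.
have h (j i : 'I_L) : trigpoly th
    (fun n => cos (pi *+ 2 * ((j%:R - i%:R) * (n%:R * th + y)))) (j == i)%:R.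
  apply: trigpoly_eq (trigpoly_wave th 1 (j%:Z - i%:Z) (pi *+ 2 * ((j%:R - i%:R) * y))) _ _.
    by move=> n; rewrite mul1r intrB -!pmulrn; congr cos; ring.
  rewrite subr_eq0 eqz_nat; case: eqVneq => [/ord_inj ->|ji].
    by rewrite subrr mul0r mulr0 cos0 mulr1 eqxx.
  by rewrite -val_eqE /= (negPf ji).
apply: trigpoly_eq (trigpoly_sum (fun j => trigpoly_sum (h j))) _ _ => //.
rewrite -[RHS]mulr1 -[in RHS](card_ord L) mulr_natl -sumr_const; apply: eq_bigr => j _.
by rewrite (bigD1 j) //= eqxx big1 ?addr0 // => i; rewrite eq_sym => /negPf ->.
Qed.

End Fejer.

(** * Approximation of the sawtooth in mean *)

Section Sawtooth.
Variable R : realType.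
Implicit Types (x : R) (L : nat).

Definition frac x : R := x - (Num.floor x)%:~R.

Lemma frac_ge0 x : 0 <= frac x.
Proof. by rewrite subr_ge0 ge_floor. Qed.

Lemma frac_lt1 x : frac x < 1.
Proof. by rewrite ltrBlDl -intrD1 lt_succ_floor. Qed.

Lemma fejer_frac L x y : fejer L (frac x - y) = fejer L (x - y).
Proof.
by rewrite -[RHS](fejer_periodic _ _ (- Num.floor x)) /frac; congr fejer; rewrite intrN; ring.
Qed.

(* The discrete convolution of the sawtooth with the Fejer kernel. *)
Definition smooth_frac L x : R :=
  L%:R ^- 2 * \sum_(r < L) (r%:R / L%:R * fejer L (x - r%:R / L%:R)).

(** The kernel has grid sum [L ^ 2], so a bound [a * kernel + b] at each grid point averages to
    [a + b / L]. *)
Lemma smooth_frac_close L x (a b : R) : (0 < L)%N ->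
  (forall r : 'I_L, `|frac x - r%:R / L%:R| * fejer L (frac x - r%:R / L%:R) <=
     a * fejer L (frac x - r%:R / L%:R) + b) ->
  `|frac x - smooth_frac L x| <= a + b / L%:R.
Proof.
move=> L0 h; have L0' : (L%:R : R) != 0 by rewrite pnatr_eq0 -lt0n.
have L2 : 0 < (L%:R : R) ^+ 2 by rewrite exprn_gt0 // ltr0n.
have -> : frac x - smooth_frac L x = L%:R ^- 2 *
    \sum_(r < L) ((frac x - r%:R / L%:R) * fejer L (frac x - r%:R / L%:R)).
  have E : frac x = L%:R ^- 2 * \sum_(r < L) (frac x * fejer L (x - r%:R / L%:R)).
    by rewrite -mulr_sumr fejer_grid_sum mulrC mulfK // lt0r_neq0.
  rewrite {1}E -mulrBr -sumrB; congr (_ * _); apply: eq_bigr => r _.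
  by rewrite (fejer_frac L x (r%:R / L%:R)) -mulrBl.
rewrite normrM ger0_norm ?invr_ge0 ?(ltW L2) // ler_pdivrMl //.
apply: (le_trans (ler_norm_sum _ _ _)).
apply: (@le_trans _ _ (\sum_(r < L) (a * fejer L (x - r%:R / L%:R) + b))).
  apply: ler_sum => r _; rewrite normrM (ger0_norm (fejer_ge0 _ _)).
  by apply: (le_trans (h r)); rewrite fejer_frac.
rewrite big_split /= -mulr_sumr fejer_grid_sum sumr_const card_ord -mulr_natr.
rewrite le_eqVlt; apply/orP; left; apply/eqP; by field.
Qed.

Lemma grid_dist_lt1 L x (r : 'I_L) : `|frac x - r%:R / L%:R| < 1.
Proof.
have L0 : 0 < (L%:R : R) by rewrite ltr0n (leq_ltn_trans _ (ltn_ord r)).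
have r0 : 0 <= (r%:R / L%:R : R) by rewrite divr_ge0 // ltW.
have r1 : (r%:R / L%:R : R) < 1 by rewrite ltr_pdivrMr // mul1r ltr_nat.
by rewrite ltr_norml; have := frac_ge0 x; have := frac_lt1 x; lra.
Qed.

Lemma smooth_frac_le1 L x : (0 < L)%N -> `|frac x - smooth_frac L x| <= 1.
Proof.
move=> L0; rewrite -[leRHS]addr0 -[X in _ <= _ + X](mul0r (L%:R^-1)).
apply: smooth_frac_close => // r; rewrite addr0 ler_wpM2r ?fejer_ge0 //.
exact/ltW/grid_dist_lt1.
Qed.

Lemma sin_pi_sqr_ge (d y : R) : 0 <= d -> d <= `|y| -> `|y| <= 1 - d ->
  sin (pi * d) ^+ 2 <= sin (pi * y) ^+ 2.
Proof.
move=> d0 dy yd; rewrite !sin2cos2 lerD2l lerN2.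
have p0 := pi_gt0 R.
have -> : cos (pi * y) = cos (pi * `|y|) by rewrite -cos_norm normrM gtr0_norm.
have y0 := normr_ge0 y; move: `|y| y0 dy yd => z z0 dz zd.
have in0 (t : R) : 0 <= t -> t <= 1 -> pi * t \in `[0, pi].
  by move=> t0 t1; rewrite in_itv /= mulr_ge0 ?(ltW p0) //= ler_piMr // ltW.
have cz : cos (pi * z) <= cos (pi * d).
  by rewrite leNgt ltr_cos ?in0 ?ltr_pM2l // -?leNgt //; lra.
have cz' : cos (pi * (1 - d)) <= cos (pi * z).
  by rewrite leNgt ltr_cos ?in0 ?ltr_pM2l // -?leNgt //; lra.
have E : cos (pi * (1 - d)) = - cos (pi * d).
  by rewrite mulrBr mulr1 cosB cospi sinpi mul0r addr0 mulN1r.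
by rewrite E in cz'; nra.
Qed.

(** Grid points closer than [d] cost at most [d]. The others are at distance between [d] and
    [1 - d], because [frac x] stays away from 0 and 1; they are far modulo 1 as well, and [fejer_le]
    bounds the kernel there independently of [L]. *)
Lemma smooth_frac_le L x (d : R) : (0 < L)%N -> 0 < d -> d < 1 -> d <= frac x -> frac x <= 1 - d ->
  `|frac x - smooth_frac L x| <= d + 2 / sin (pi * d) ^+ 2 / L%:R.
Proof.
move=> L0 d0 d1 dx xd; have p0 := pi_gt0 R.
have s0 : 0 < sin (pi * d) by apply: sin_gt0_pi; rewrite mulr_gt0 //= gtr_pMr.
have s2 : 0 < sin (pi * d) ^+ 2 by rewrite exprn_gt0.
apply: smooth_frac_close => // r; set F := fejer _ _.
have F0 : 0 <= F by exact: fejer_ge0.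
have [near|far] := ltP `|frac x - r%:R / L%:R| d.
  by rewrite ler_wpDr ?divr_ge0 ?(ltW s2) // ler_wpM2r // ltW.
have L0' : 0 < (L%:R : R) by rewrite ltr0n.
have r0 : 0 <= (r%:R / L%:R : R) by rewrite divr_ge0 // ltW.
have r1 : (r%:R / L%:R : R) < 1 by rewrite ltr_pdivrMr // mul1r ltr_nat.
have far' : `|frac x - r%:R / L%:R| <= 1 - d by rewrite ler_norml; lra.
have hF : F <= 2 / sin (pi * d) ^+ 2.
  rewrite ler_pdivlMr //; apply: le_trans (fejer_le L (frac x - r%:R / L%:R)).
  by rewrite mulrC ler_wpM2r // sin_pi_sqr_ge // ltW.
have h1 : `|frac x - r%:R / L%:R| * F <= F by rewrite ler_piMl // ltW // grid_dist_lt1.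
have h2 : 0 <= d * F by rewrite mulr_ge0 // ltW.
lra.
Qed.

Lemma smooth_frac_trigpoly L (th : R) :
  exists a, trigpoly th (fun n => smooth_frac L (n%:R * th)) a.
Proof.
exists (L%:R ^- 2 * \sum_(r < L) (r%:R / L%:R * L%:R)).
by apply: trigpolyZ; apply: trigpoly_sum => r; apply/trigpolyZ/fejer_trigpoly.
Qed.

Section Irrational.
Variable th : R.
Hypothesis th_irr : forall h z : int, h != 0 -> h%:~R * th != z%:~R.

(** Near an integer the kernel is at least [K ^ 2 / 2], while its mean along [n * th] is [K], hence
    eventually at most [2 K]; such [n] have proportion at most [4 / K]. *)
Lemma frac_near_int K : (0 < K)%N -> exists N0, forall N, (N0 <= N)%N ->
  \sum_(n < N) (~~ ((8 * K%:R)^-1 <= frac (n%:R * th) <= 1 - (8 * K%:R)^-1))%:R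
     <= 4 / K%:R * N%:R :> R.
Proof.
move=> K0; have K0' : 0 < (K%:R : R) by rewrite ltr0n.
have [N0 h] := trigpoly_mean th_irr (fejer_trigpoly K th 0) K0'.
exists N0 => N /h; rewrite ler_norml => /andP[_]; rewrite lerBlDr -mulrDl => hs.
have key (n : nat) : (~~ ((8 * K%:R)^-1 <= frac (n%:R * th) <= 1 - (8 * K%:R)^-1))%:R <=
    2 / K%:R ^+ 2 * fejer K (n%:R * th + 0).
  have f0 := fejer_ge0 K (n%:R * th + 0).
  have K2 : 0 < (K%:R : R) ^+ 2 by rewrite exprn_gt0.
  have [_|/= near] := boolP (_ <= _ <= _); first by rewrite mulr_ge0 // divr_ge0 // ltW.
  rewrite mulrAC ler_pdivlMr // mul1r -ler_pdivrMl // mulrC addr0.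
  have Ef (z : int) : fejer K (n%:R * th) = fejer K (frac (n%:R * th) + z%:~R).
    by rewrite fejer_periodic -[in RHS](subr0 (frac _)) fejer_frac subr0.
  have := frac_ge0 (n%:R * th); have := frac_lt1 (n%:R * th) => y1 y0.
  move: near; rewrite negb_and -!ltNge => /orP[lo|hi].
    by rewrite (Ef 0) addr0; apply: fejer_near0; rewrite ger0_norm // ltW.
  by rewrite (Ef (-1)); apply: fejer_near0; rewrite ler_norml; lra.
apply: (@le_trans _ _ (\sum_(n < N) (2 / K%:R ^+ 2 * fejer K (n%:R * th + 0)))).
  by apply: ler_sum => i _; exact: key.
rewrite -mulr_sumr; apply: (le_trans (ler_wpM2l _ hs)).
  by rewrite divr_ge0 // exprn_ge0 // ltW.
rewrite le_eqVlt; apply/orP; left; apply/eqP; field; exact: lt0r_neq0.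
Qed.

Lemma frac_approx (e : R) : 0 < e ->
  exists t a, trigpoly th t a /\ mean_close (fun n => frac (n%:R * th)) t e.
Proof.
(* [16 / e] makes the exceptional proportion [4 / K] at most [e / 4], where the error is at most 1.
   Elsewhere [d] and the kernel term cost [e / 4] each; [L] is chosen last, as it depends on [d]. *)
move=> e0; pose K := (Num.truncn (16 / e)).+1.
have K0' : 0 < (K%:R : R) by rewrite ltr0n.
have hK : 16 / e < K%:R by exact: truncnS_gt.
have hK' : 16 < e * K%:R by rewrite mulrC -ltr_pdivrMr.
pose d : R := (8 * K%:R)^-1.
have d0 : 0 < d by rewrite invr_gt0 mulr_gt0.
have K1 : 1 <= (K%:R : R) by rewrite ler1n.
have d1 : d < 1 by rewrite invf_lt1 ?mulr_gt0 //; lra.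
have de : d <= e / 4.
  by rewrite /d -[leLHS]mul1r ler_pdivrMr ?mulr_gt0 //; lra.
have Ke : 4 / K%:R <= e / 4 by rewrite ler_pdivrMr //; lra.
have s0 : 0 < sin (pi * d) ^+ 2.
  by rewrite exprn_gt0 // sin_gt0_pi // mulr_gt0 ?pi_gt0 //= gtr_pMr ?pi_gt0.
pose L := (Num.truncn (2 / sin (pi * d) ^+ 2 / (e / 4))).+1.
have hL : 2 / sin (pi * d) ^+ 2 / L%:R <= e / 4.
  rewrite ler_pdivrMr ?ltr0n // [leRHS]mulrC -ler_pdivrMr ?divr_gt0 //.
  exact/ltW/truncnS_gt.
have [a ta] := smooth_frac_trigpoly L th.
have [N0 hN] := @frac_near_int K isT.
exists (fun n => smooth_frac L (n%:R * th)), a; split => //; exists N0 => N /hN near.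
apply: (@le_trans _ _ (\sum_(n < N) (e / 2 +
    (~~ ((8 * K%:R)^-1 <= frac (n%:R * th) <= 1 - (8 * K%:R)^-1))%:R))).
  apply: ler_sum => n _; have [/andP[lo hi]|_] := boolP (_ <= _ <= _).
    by rewrite addr0; apply: (le_trans (smooth_frac_le _ d0 d1 lo hi)) => //; lra.
  by apply: (le_trans (smooth_frac_le1 _ _)) => //=; lra.
rewrite big_split /=.
have -> : \sum_(n < N) (e / 2) = e / 2 * N%:R by rewrite sumr_const card_ord mulr_natr.
apply: (le_trans (lerD (lexx _) near)); rewrite -mulrDl ler_wpM2r //; lra.
Qed.

End Irrational.
End Sawtooth.

(** * Sequences approximable in mean with a prescribed constant term *)

Section Approximable.
Variables (R : realType) (th : R).
Implicit Types (f g : nat -> R) (c d : R).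

(** All approximants have the exact constant term [c], so replacing a factor by one of them leaves
    the predicted mean of a product unchanged. *)
Definition approximable f c : Prop := forall e, 0 < e ->
  exists t, trigpoly th t c /\ mean_close f t e.

Lemma approximable_cst c : approximable (fun=> c) c.
Proof.
move=> e e0; exists (fun=> c); split; [exact: trigpoly_cst|exact: mean_close_refl].
Qed.

Lemma approximableD f g c d : approximable f c -> approximable g d ->
  approximable (fun n => f n + g n) (c + d).
Proof.
move=> hf hg e e0; have e2 : 0 < e / 2 by rewrite divr_gt0.
have [t [tc ft]] := hf _ e2; have [s [sd gs]] := hg _ e2.
exists (fun n => t n + s n); split; first exact: trigpolyD.
by rewrite [e]splitr; exact: mean_closeD.
Qed.

Lemma approximableN f c : approximable f c -> approximable (fun n => - f n) (- c).
Proof.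
move=> hf e e0; have [t [tc ft]] := hf _ e0.
exists (fun n => - t n); split; last exact: mean_closeN.
apply: trigpoly_eq (trigpolyZ (-1) tc) _ _ => [n|]; by rewrite mulN1r.
Qed.

Lemma approximable_shift f c : approximable f c -> approximable (fun n => f n.+1) c.
Proof.
move=> hf e e0; have e2 : 0 < e / 2 by rewrite divr_gt0.
have [t [tc ft]] := hf _ e2; exists (fun n => t n.+1); split.
  exact: trigpoly_shift.
by rewrite [e]splitr; exact: mean_close_shift.
Qed.

(* The unknown constant term of the approximant of the sawtooth cancels. *)
Lemma approximable_coboundary :
  (forall h z : int, h != 0 -> h%:~R * th != z%:~R) ->
  approximable (fun n => frac (n%:R * th) - frac (n.+1%:R * th)) 0.
Proof.
move=> irr e e0; have e4 : 0 < e / 4 by rewrite divr_gt0.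
have [t [a [ta vt]]] := frac_approx irr e4.
exists (fun n => t n + - t n.+1); split.
  rewrite -(subrr a); apply: trigpolyD => //.
  apply: trigpoly_eq (trigpolyZ (-1) (trigpoly_shift ta)) _ _ => [n|]; by rewrite mulN1r.
have [N0 h] := mean_closeD vt (mean_closeN (mean_close_shift e4 vt)).
exists N0 => N /h /le_trans; apply; rewrite ler_wpM2r //; lra.
Qed.

End Approximable.

(** * Means of products under linear independence *)

Section ProductMean.
Variable R : realType.

(** The frequencies that the factors attached to [L] can produce, up to integers, which a wave does
    not see. *)
Definition zspan (L : seq R) (b : R) : Prop := exists (z : int) (h : R -> int),
  b = z%:~R + \sum_(l <- L) (h l)%:~R * l^-1.

Definition zfree (L : seq R) : Prop := forall (z : int) (h : R -> int),
  z%:~R + \sum_(l <- L) (h l)%:~R * l^-1 = 0 -> forall l, l \in L -> h l = 0.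

Lemma zspanN L b : zspan L b -> zspan L (- b).
Proof.
move=> [z [h ->]]; exists (- z), (fun l => - h l).
rewrite opprD intrN -sumrN; congr (_ + _); apply: eq_bigr => l _.
by rewrite intrN mulNr.
Qed.

Lemma zspan_cons (l : R) L b (h : int) : l \notin L -> zspan L b ->
  zspan (l :: L) (b + h%:~R * l^-1).
Proof.
move=> lL [z [g ->]]; exists z, (fun x => if x == l then h else g x).
rewrite big_cons eqxx -addrA [X in _ + X]addrC; congr (_ + (_ + _)).
rewrite !big_seq; apply: eq_bigr => x xL; case: eqP => // xl.
by rewrite -xl xL in lL.
Qed.

Lemma zspan0 L : zspan L 0.
Proof.
by exists 0, (fun=> 0); rewrite big1 ?addr0 // => l _; rewrite mul0r.
Qed.

Lemma zfree_head (l : R) L (h : int) : l \notin L -> zfree (l :: L) -> h != 0 ->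
  ~ zspan L (h%:~R * l^-1).
Proof.
move=> lL fr h0 [z [g Eg]].
have := fr z (fun x => if x == l then - h else g x) _ l (mem_head _ _).
rewrite eqxx => E; move: h0; rewrite -oppr_eq0 E ?eqxx //.
rewrite big_cons eqxx intrN mulNr Eg.
rewrite [X in _ + (_ + X)](_ : _ = \sum_(x <- L) (g x)%:~R * x^-1); first by ring.
rewrite !big_seq; apply: eq_bigr => x xL.
by case: eqP => // xl; rewrite -xl xL in lL.
Qed.

(** By product-to-sum, [b] becomes [h / l + b] and [h / l - b]. For [h != 0] both lie outside
    [zspan L] by freeness, so the hypothesis on [W] gives mean zero; only [h = 0] contributes. *)
Lemma has_mean_wave_trigpoly (l : R) L (W t : nat -> R) (m w b p : R) :
  l \notin L -> zfree (l :: L) ->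
  (forall b p, (b = 0 \/ ~ zspan L b) ->
     has_mean (fun n => W n * wave b p n) (if b == 0 then w * cos p else 0)) ->
  (b = 0 \/ ~ zspan (l :: L) b) -> trigpoly l^-1 t m ->
  has_mean (fun n => W n * t n * wave b p n) (if b == 0 then w * m * cos p else 0).
Proof.
move=> lL fr hW hb; elim=> {t m} [c h q|u v x y _ IHu _ IHv]; last first.
  have -> : (if b == 0 then w * (x + y) * cos p else 0) =
    (if b == 0 then w * x * cos p else 0) + (if b == 0 then w * y * cos p else 0).
    by case: ifP => _; ring.
  have -> : (fun n => W n * (u n + v n) * wave b p n) =
    (fun n => W n * u n * wave b p n + W n * v n * wave b p n).
    by apply/funext => n; ring.
  exact: has_meanD.
have nz (b' : R) : h != 0 -> (b' = b \/ b' = - b) -> ~ zspan L (h%:~R * l^-1 + b').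
  move=> h0 Eb' hz.
  have : zspan (l :: L) b'.
    rewrite (_ : b' = h%:~R * l^-1 + b' + (- h)%:~R * l^-1); last by rewrite intrN; ring.
    exact: zspan_cons.
  case: hb => [b0 _|nb hb'].
    have Eb0 : b' = 0 by case: Eb' => ->; rewrite b0 ?oppr0.
    by move: hz; rewrite Eb0 addr0; exact: zfree_head.
  by apply: nb; case: Eb' hb' => -> // /zspanN; rewrite opprK.
have adm (b' : R) : (b' = b \/ b' = - b) ->
    h%:~R * l^-1 + b' = 0 \/ ~ zspan L (h%:~R * l^-1 + b').
  move=> Eb'; have [h0|h0] := eqVneq h 0; last by right; exact: nz.
  rewrite h0 mul0r add0r; case: hb => [b0|nb].
    by left; case: Eb' => ->; rewrite b0 ?oppr0.
  right => /(zspan_cons 0 lL); rewrite mul0r addr0.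
  by case: Eb' => -> // /zspanN; rewrite opprK.
have h1 := hW _ (q + p) (adm b (or_introl erefl)).
have h2 := hW _ (q - p) (adm (- b) (or_intror erefl)).
have -> : (fun n => W n * (c * wave (h%:~R * l^-1) q n) * wave b p n) =
  fun n => (c / 2) * (W n * wave (h%:~R * l^-1 + b) (q + p) n +
                      W n * wave (h%:~R * l^-1 - b) (q - p) n).
  by apply/funext => n; rewrite mulrA -[LHS]mulrA waveM; field.
have -> : (if b == 0 then w * (if h == 0 then c * cos q else 0) * cos p else 0) =
  (c / 2) * ((if h%:~R * l^-1 + b == 0 then w * cos (q + p) else 0) +
             (if h%:~R * l^-1 - b == 0 then w * cos (q - p) else 0)).
  have [h0|h0] := eqVneq h 0.
    rewrite h0 mul0r add0r sub0r oppr_eq0; case: ifP => _; last by rewrite addr0 mulr0.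
    by rewrite cosD cosB; field.
  have nz0 (b' : R) : (b' = b \/ b' = - b) -> (h%:~R * l^-1 + b' == 0) = false.
    by move=> Eb'; apply/eqP => E0; apply: (nz b' h0 Eb'); rewrite E0; exact: zspan0.
  rewrite !nz0; [|by right|by left].
  by rewrite mulr0 mul0r if_same addr0 mulr0.
by apply: has_meanZ; exact: has_meanD.
Qed.

(** The extra wave strengthens the induction: approximating one factor multiplies the remaining
    product by waves. Nonzero [b] in [zspan L] is excluded because it could resonate with the
    factors. *)
Theorem has_mean_prod_wave (L : seq R) (F : R -> nat -> R) (c : R -> R) :
  uniq L -> zfree L ->
  (forall l n, l \in L -> `|F l n| <= 1) ->
  (forall l, l \in L -> approximable l^-1 (F l) (c l)) ->
  forall b p, (b = 0 \/ ~ zspan L b) ->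
  has_mean (fun n => (\prod_(l <- L) F l n) * wave b p n)
           (if b == 0 then (\prod_(l <- L) c l) * cos p else 0).
Proof.
elim: L => [|l L IH] uL fL F1 Fc b p hb.
  rewrite !big_nil !mul1r.
  have -> : (fun n => \prod_(l <- [::]) F l n * wave b p n) = wave b p.
    by apply/funext => n; rewrite big_nil mul1r.
  case: eqVneq hb => [-> _|b0 [/eqP|nb]]; last 2 first.
  - by rewrite (negPf b0).
  - apply: wave_mean0 => z; apply/eqP => Ez; apply: nb; exists z, (fun=> 0).
    by rewrite big_nil addr0.
  have -> : wave 0 p = fun=> cos p by apply/funext => n; rewrite wave0.
  exact: has_mean_cst.
move: uL; rewrite /= => /andP[lL uL].
have fL' : zfree L.
  move=> z h E x xL; have := fL z (fun x => if x == l then 0 else h x) _ x.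
  have xl : (x == l) = false by apply/eqP => xl; rewrite -xl xL in lL.
  rewrite xl inE xL orbT; apply => //; rewrite big_cons eqxx mul0r add0r -[RHS]E; congr (_ + _).
  rewrite big_seq [RHS]big_seq; apply: eq_bigr => y yL.
  by case: eqP => // yl; rewrite -yl yL in lL.
have IH' := IH uL fL' (fun x n xL => F1 x n (mem_behead (s := l :: L) xL))
  (fun x xL => Fc x (mem_behead (s := l :: L) xL)).
apply: has_mean_close => e e0.
have [t [tc Ft]] := Fc l (mem_head _ _) _ e0.
exists (fun n => (\prod_(x <- L) F x n) * t n * wave b p n),
  (if b == 0 then (\prod_(x <- l :: L) c x) * cos p else 0); split.
  rewrite big_cons [c l * _]mulrC.
  exact: (has_mean_wave_trigpoly (W := fun n => \prod_(x <- L) F x n) p lL fL IH' hb tc).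
  by rewrite subrr normr0 ltW.
case: Ft => N0 hN; exists N0 => N /hN; apply: le_trans; apply: ler_sum => n _.
rewrite big_cons [F l n * _]mulrC -mulrBl -mulrBr normrM normrM.
have P1 : `|\prod_(x <- L) F x n| <= 1.
  rewrite normr_prod big_seq; apply: prodr_ile1 => x xL.
  by rewrite normr_ge0 F1 // inE xL orbT.
have w1 := wave_norm_le1 b p n.
rewrite -[leRHS]mulr1 -[leRHS]mul1r mulrA; apply: ler_pM => //.
by apply: ler_pM.
Qed.

Corollary has_mean_prod (L : seq R) (F : R -> nat -> R) (c : R -> R) :
  uniq L -> zfree L ->
  (forall l n, l \in L -> `|F l n| <= 1) ->
  (forall l, l \in L -> approximable l^-1 (F l) (c l)) ->
  has_mean (fun n => \prod_(l <- L) F l n) (\prod_(l <- L) c l).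
Proof.
move=> uL fL F1 Fc; have := has_mean_prod_wave uL fL F1 Fc 0 (or_introl erefl).
rewrite eqxx cos0 mulr1.
have -> // : (fun n => \prod_(l <- L) F l n * wave 0 0 n) = fun n => \prod_(l <- L) F l n.
by apply/funext => n; rewrite wave0 cos0 mulr1.
Qed.

End ProductMean.

(** * Powers hit by multiples of elements of Lambda *)

Section Hits.
Variables (R : realType) (k : nat).
Hypothesis k_ge2 : (2 <= k)%N.
Let k_gt0 : (0 < k)%N. Proof. exact: ltn_trans k_ge2. Qed.
Implicit Types (l : R) (n a m : nat).

(** The condition that [a ^ k * l ^ k] lies strictly between consecutive powers, after [k]-th roots.
    The strict lower bound forces [a > 0]. *)
Definition hit l n : bool := `[< exists a : nat, n%:R < a%:R * l < n.+1%:R >].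

Lemma Lambda_gt0 l : inLambda k l -> 0 < l.
Proof. by move=> /(inLambda_gt2 k_ge2); exact: lt_trans. Qed.

Lemma Lambda_irrational l (h z : int) : inLambda k l -> h != 0 -> h%:~R * l^-1 != z%:~R.
Proof.
move=> Ll h0; apply/eqP => E; have l0 := Lambda_gt0 Ll.
have Eh : h%:~R = z%:~R * l by rewrite -E divfK // lt0r_neq0.
have z0 : z != 0.
  by apply: contraNneq h0 => z0; move: Eh; rewrite z0 mul0r => /eqP; rewrite intr_eq0.
have : l = 1.
  apply: (reduced_radical_ratio k_ge2 (q := h%:~R / z%:~R) (inLambda_reduced k_ge2 Ll)
            (reduced_radical1 _ _)).
  by rewrite mulr1 fmorph_div /= !ratr_int Eh mulrAC divff ?mul1r // intr_eq0.
by have := inLambda_gt2 k_ge2 Ll; lra.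
Qed.

Lemma Lambda_zfree (L : seq R) : uniq L -> (forall l, l \in L -> inLambda k l) -> zfree L.
Proof.
move=> uL hL z h E.
pose s := 1 :: map (@GRing.inv R) L.
pose c (x : R) : rat := if x == 1 then z%:~R else (h x^-1)%:~R.
have L0 l : l \in L -> 0 < l by move=> /hL/Lambda_gt0.
have n1 l : l \in L -> l^-1 != 1.
  move=> lL; rewrite invr_eq1; apply/eqP => l1.
  by have := inLambda_gt2 k_ge2 (hL _ lL); rewrite l1; lra.
have us : uniq s.
  rewrite /= map_inj_uniq ?uL ?andbT; last exact: invr_inj.
  by apply/negP => /mapP[l lL /esym/eqP]; rewrite (negPf (n1 _ lL)).
have redV x : x \in s -> reduced_radical k x^-1.
  rewrite inE => /orP[/eqP ->|/mapP[l lL ->]].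
    by rewrite invr1; exact: reduced_radical1.
  by rewrite invrK; apply: inLambda_reduced => //; exact: hL.
have key := @real_radicals_free R k s c k_gt0 us.
move=> l lL; have := key _ _ _ l^-1.
rewrite /c (negPf (n1 _ lL)) invrK => H; apply/eqP; rewrite -(intr_eq0 rat); apply/eqP; apply: H.
- move=> x /redV[x0 [m [m0 Em _]]]; split; first by rewrite -invr_gt0.
  by exists (m%:R^-1); rewrite fmorphV /= ratr_nat -Em exprVn invrK.
(* A rational ratio between two inverses is one between the elements themselves, with the roles
   exchanged. *)
- move=> x y q xs ys Exy; apply: invr_inj; symmetry.
  apply: (reduced_radical_ratio k_ge2 (q := q) (redV _ ys) (redV _ xs)).
  have x0 : x != 0 by have [+ _] := redV _ xs; rewrite invr_gt0 => /lt0r_neq0.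
  have y0 : y != 0 by have [+ _] := redV _ ys; rewrite invr_gt0 => /lt0r_neq0.
  have q0 : ratr q != 0 :> R by apply: contraNneq x0 => q0; rewrite Exy q0 mul0r.
  by rewrite Exy; field; rewrite y0 q0.
- rewrite big_cons big_map eqxx ratr_int mulr1 -[RHS]E; congr (_ + _).
  by rewrite big_seq [RHS]big_seq; apply: eq_bigr => x xL; rewrite (negPf (n1 _ xL)) invrK ratr_int.
- by rewrite inE map_f ?orbT.
Qed.

(** As [0 < t < 1], passing from [n * t] to [n.+1 * t] raises the floor by 0 or 1, and by 1 exactly
    when an integer is crossed; irrationality excludes an integer at the right end. *)
Lemma hit_frac l n : inLambda k l ->
  (hit l n)%:R = l^-1 + (frac (n%:R * l^-1) - frac (n.+1%:R * l^-1)).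
Proof.
move=> Ll; have l0 := Lambda_gt0 Ll; have l2 := inLambda_gt2 k_ge2 Ll.
have irr (h z : int) : h != 0 -> h%:~R * l^-1 != z%:~R by exact: Lambda_irrational.
set t := l^-1; have t0 : 0 < t by rewrite invr_gt0.
have t1 : t < 1 by rewrite invf_lt1 //; lra.
rewrite /frac; set A := Num.floor (n%:R * t); set B := Num.floor (n.+1%:R * t).
have -> : t + (n%:R * t - A%:~R - (n.+1%:R * t - B%:~R)) = B%:~R - A%:~R.
  by rewrite -natr1; ring.
have A1 : A%:~R <= n%:R * t by exact: ge_floor.
have A2 : n%:R * t < A%:~R + 1 by rewrite -intrD1 lt_succ_floor.
have B1 : B%:~R <= n.+1%:R * t by exact: ge_floor.
have B2 : n.+1%:R * t < B%:~R + 1 by rewrite -intrD1 lt_succ_floor.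
have Et : n.+1%:R * t = n%:R * t + t by rewrite -natr1 mulrDl mul1r.
have nt0 : 0 <= n%:R * t by rewrite mulr_ge0 // ltW.
have AB : A <= B by rewrite -ltzD1 -(ltr_int R) intrD1; lra.
have BA : B <= A + 1 by rewrite -ltzD1 -(ltr_int R) !intrD1; lra.
have e1 (x y : R) : (x < y * l) = (x * t < y) by rewrite ltr_pdivrMr.
have e2 (x y : R) : (x * l < y) = (x < y * t) by rewrite ltr_pdivlMr.
have hitE : hit l n = (B == A + 1).
  apply/asboolP/eqP => [[a /andP[]]|EB].
    rewrite e1 e2 => h1 h2.
    apply/eqP; rewrite eq_le BA /=.
    have Aa : A < a%:Z by rewrite -(ltr_int R) -pmulrn; lra.
    have aB : a%:Z <= B by rewrite -ltzD1 -(ltr_int R) intrD1 -pmulrn; lra.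
    by rewrite (le_trans _ aB) // lezD1.
  have A0 : 0 <= A by rewrite floor_ge0.
  have B0 : 0 <= B by rewrite EB addr_ge0.
  have EBn : (`|B|%N%:R : R) = B%:~R by rewrite pmulrn gez0_abs.
  exists `|B|%N; rewrite EBn e1 e2; apply/andP; split.
    by rewrite EB intrD1.
  by rewrite lt_neqAle B1 andbT eq_sym; exact: (irr n.+1%:Z).
rewrite hitE; case: eqP => [->|nB]; first by rewrite intrD1 /= addrAC subrr add0r.
have -> : B = A by move: AB BA nB; clear; lia.
by rewrite subrr.
Qed.

(** Two multiples of [l] differ by more than 2, the length of the two intervals together. *)
Lemma hit_next l n : inLambda k l -> hit l n -> ~~ hit l n.+1.
Proof.
move=> Ll /asboolP[a /andP[a1 a2]]; apply/negP => /asboolP[b /andP[b1 b2]].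
have l2 := inLambda_gt2 k_ge2 Ll; have l0 := Lambda_gt0 Ll.
have ab : (a < b)%N by rewrite -(ltr_nat R) -(ltr_pM2r l0); exact: lt_trans b1.
have : a.+1%:R * l <= b%:R * l by rewrite ler_pM2r // ler_nat.
by move: b2 a1; rewrite -!natr1 => *; lra.
Qed.

Lemma hit_approximable l : inLambda k l ->
  approximable l^-1 (fun n => (hit l n)%:R) l^-1.
Proof.
move=> Ll; rewrite -[X in approximable _ _ X]addr0.
have -> : (fun n => (hit l n)%:R) =
  fun n => l^-1 + (frac (n%:R * l^-1) - frac (n.+1%:R * l^-1)).
  by apply/funext => n; rewrite hit_frac.
apply: approximableD (approximable_cst _ _) (approximable_coboundary _).
by move=> h z; exact: Lambda_irrational.
Qed.

Lemma between_powers l n n' a m : 0 < l -> m%:R = a%:R ^+ k * l ^+ k ->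
  (n ^ k < m < n' ^ k)%N = (n%:R < a%:R * l < n'%:R).
Proof.
move=> l0 Em; rewrite -!(ltr_nat R) !natrX Em -exprMn.
by rewrite !ltr_pXn2r ?nnegrE ?mulr_ge0 ?(ltW l0).
Qed.

Lemma Lambda_unique l l' a a' : inLambda k l -> inLambda k l' -> (0 < a)%N ->
  a%:R ^+ k * l ^+ k = a'%:R ^+ k * l' ^+ k -> l = l'.
Proof.
move=> Ll Ll' a0; rewrite -!exprMn => /eqP.
have l0 := Lambda_gt0 Ll; have l0' := Lambda_gt0 Ll'.
rewrite eqrXn2 ?mulr_ge0 ?(ltW l0) ?(ltW l0') // => /eqP E.
apply: (reduced_radical_ratio k_ge2 (q := a'%:R / a%:R)); try exact: inLambda_reduced.
have an0 : a%:R != 0 :> R by rewrite pnatr_eq0 -lt0n.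
by rewrite fmorph_div /= !ratr_nat mulrAC -E mulrC mulKf.
Qed.

Lemma Lambda_nat l a : inLambda k l -> exists m : nat, m%:R = a%:R ^+ k * l ^+ k.
Proof.
move=> /(inLambda_reduced k_ge2)[_ [m [_ Em _]]].
by exists (a ^ k * m)%N; rewrite natrM natrX Em.
Qed.

(** Each [l] gives at most one integer, since [l] exceeds the gap between [n] and [n.+1]; distinct
    elements give distinct integers by [Lambda_unique]. *)
Lemma cnt_open_seq (I : seq R) n : uniq I -> (forall l, l \in I -> inLambda k l) ->
  cnt_open k (fun l => l \in I) (n ^ k) (n.+1 ^ k) = count (hit ^~ n) I.
Proof.
move=> uI IL; rewrite /cnt_open -!size_filter.
have /choice[f fP] : forall l, exists m : nat, l \in I -> hit l n ->
    exists a : nat, n%:R < a%:R * l < n.+1%:R /\ m%:R = a%:R ^+ k * l ^+ k.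
  move=> l; have [lI|_] := boolP (l \in I); last by exists 0%N.
  have [/asboolP[a ha]|_] := boolP (hit l n); last by exists 0%N.
  by have [m Em] := Lambda_nat a (IL _ lI); exists m => _ _; exists a.
have pos l a : 0 < l -> n%:R < a%:R * l -> (0 < a)%N.
  move=> l0; case: a => //; rewrite mul0r => h.
  by have := ler0n R n; rewrite leNgt h.
rewrite -(size_map f); apply/perm_size/uniq_perm.
- exact/filter_uniq/iota_uniq.
- rewrite map_inj_in_uniq ?filter_uniq // => l l'.
  rewrite !mem_filter => /andP[hl lI] /andP[hl' lI'] Ef.
  have [a [/andP[h1 _] Ea]] := fP _ lI hl; have [a' [_ Ea']] := fP _ lI' hl'.
  apply: (@Lambda_unique _ _ a a'); rewrite -?Ea -?Ea' ?Ef //; [exact: IL|exact: IL|].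
  exact: (pos _ _ (Lambda_gt0 (IL _ lI)) h1).
- move=> m; rewrite mem_filter mem_index_iota; apply/andP/mapP.
  + move=> [/asboolP[a [a0 [l [lI Em]]]]].
    have l0 := Lambda_gt0 (IL _ lI).
    rewrite (between_powers _ _ l0 Em) => ha.
    have hl : hit l n by apply/asboolP; exists a.
    exists l; first by rewrite mem_filter hl lI.
    have [b [/andP[b1 b2] Eb]] := fP _ lI hl; case/andP: ha => a1 a2.
    have l2 := inLambda_gt2 k_ge2 (IL _ lI).
    have step (x y : nat) : n%:R < x%:R * l -> y%:R * l < n.+1%:R -> (y <= x)%N.
      move=> h1 h2; rewrite leqNgt; apply/negP => xy.
      have : x.+1%:R * l <= y%:R * l by rewrite ler_pM2r // ler_nat.
      by move: h1 h2; rewrite -!natr1 => *; lra.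
    have ab : a = b by apply/eqP; rewrite eqn_leq !step.
    by apply/eqP; rewrite -(eqr_nat R) Em Eb ab.
  + move=> [l]; rewrite mem_filter => /andP[hl lI] ->.
    have l0 := Lambda_gt0 (IL _ lI); have [a [ha Ea]] := fP _ lI hl; split.
      apply/asboolP; exists a; split; last by exists l.
      by case/andP: ha => h1 _; exact: (pos _ _ l0 h1).
    by rewrite (between_powers _ _ l0 Ea).
Qed.

Lemma cnt_open_eq0 (P : R -> Prop) n : (forall l, P l -> inLambda k l) ->
  cnt_open k P (n ^ k) (n.+2 ^ k) = 0%N <->
  (forall l, P l -> ~~ hit l n && ~~ hit l n.+1).
Proof.
move=> PL; rewrite /cnt_open; split => [/eqP|h].
  rewrite -leqn0 leqNgt -has_count => /hasPn h l Pl.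
  have l0 := Lambda_gt0 (PL _ Pl).
  have nohit (a : nat) : ~~ (n%:R < a%:R * l < n.+2%:R).
    apply/negP => ha; have [m Em] := Lambda_nat a (PL _ Pl).
    have mI : m \in index_iota (n ^ k).+1 (n.+2 ^ k).
      by rewrite mem_index_iota (between_powers _ _ l0 Em).
    move/negP: (h m mI); apply; apply/asboolP; exists a; split; last by exists l.
    case: a ha {Em mI} => // /andP[+ _]; rewrite mul0r => h0.
    by have := ler0n R n; rewrite leNgt h0.
  apply/andP; split; apply/negP => /asboolP[a /andP[h1 h2]]; move/negP: (nohit a); apply.
    by rewrite h1 (lt_trans h2) // ltr_nat.
  by rewrite h2 andbT (lt_trans _ h1) // ltr_nat.
apply/eqP; rewrite -leqn0 leqNgt -has_count; apply/hasPn => m.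
rewrite mem_index_iota => hm; apply/negP => /asboolP[a [a0 [l [Pl Em]]]].
have l0 := Lambda_gt0 (PL _ Pl).
move: hm; rewrite (between_powers _ _ l0 Em) => /andP[h1 h2].
have /andP[n1 n2] := h _ Pl.
have [lt|gt|eq] := ltgtP (a%:R * l) n.+1%:R.
- by move/asboolP: n1; apply; exists a; rewrite h1 lt.
- by move/asboolP: n2; apply; exists a; rewrite gt h2.
(* The middle point [n.+1 ^ k] lies in the open interval but is never attained, [l] being
   irrational. *)
- have /eqP := @Lambda_irrational _ n.+1 a (PL _ Pl) isT; apply.
  by rewrite -!pmulrn -eq mulfK // lt0r_neq0.
Qed.

Lemma inB_hit (I J : seq R) n : uniq I -> uniq J ->
  (forall l, l \in I -> inLambda k l) -> (forall l, l \in J -> inLambda k l) ->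
  inB k I J n <-> [/\ (0 < n)%N, all (hit ^~ n) I, all (hit ^~ n.+1) J &
    forall l, inLambda k l -> l \notin I -> l \notin J -> ~~ hit l n && ~~ hit l n.+1].
Proof.
move=> uI uJ IL JL; rewrite /inB !cnt_open_seq // !all_count.
have := @cnt_open_eq0 (fun l => inLambda k l /\ l \notin I /\ l \notin J) n
  (fun l Pl => Pl.1).
move=> [c1 c2]; split => [[n0 [/eqP hI [/eqP hJ /c1 h]]]|[n0 /eqP hI /eqP hJ h]].
  by split => // l Ll lI lJ; apply: h.
by split => //; split => //; split => //; apply: c2 => l [Ll [lI lJ]]; exact: h.
Qed.

End Hits.

(** * Density *)

(** The Weierstrass product inequality, by induction on [s]. *)
Lemma prod_1B_ge (R : realDomainType) (s : seq R) (x : R -> R) :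
  (forall l, l \in s -> 0 <= x l <= 1) ->
  1 - \sum_(l <- s) x l <= \prod_(l <- s) (1 - x l).
Proof.
elim: s => [|l s IH] h; first by rewrite !big_nil subr0.
rewrite !big_cons; have /andP[x0 x1] := h l (mem_head _ _).
have hs y : y \in s -> 0 <= x y <= 1 by move=> ys; apply: h; rewrite inE ys orbT.
have p0 : 0 <= \prod_(y <- s) (1 - x y).
  by rewrite big_seq; apply: prodr_ge0 => y /hs /andP[_]; rewrite subr_ge0.
have p1 : \prod_(y <- s) (1 - x y) <= 1.
  rewrite big_seq; apply: prodr_ile1 => y /hs /andP[y0 y1].
  by rewrite subr_ge0 y1 gerBl.
by have := IH hs; nra.
Qed.

Lemma count_iota1 (R : nzRingType) (p : pred nat) N :
  (count p (iota 1 N))%:R = \sum_(n < N) (p n.+1)%:R :> R.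
Proof.
elim: N => [|N IH]; first by rewrite big_ord0.
have -> : iota 1 N.+1 = iota 1 N ++ [:: N.+1] by rewrite -[N.+1 in LHS]addn1 iotaD add1n.
by rewrite count_cat natrD IH big_ord_recr /= addn0.
Qed.

Section Density.
Variables (R : realType) (k : nat) (I J : seq R).
Hypotheses (k_ge2 : (2 <= k)%N) (uI : uniq I) (uJ : uniq J).
Hypotheses (IL : forall l, l \in I -> inLambda k l) (JL : forall l, l \in J -> inLambda k l).
Hypothesis IJ : forall l, l \in I -> l \notin J.

Definition others_set (X : R) : set R :=
  [set l : R | inLambda k l /\ l \notin I /\ l \notin J /\ l <= X].

Lemma finite_others X : finite_set (others_set X).
Proof.
pose N := (Num.truncn (X ^+ k)).+1.
apply: (@sub_finite_set _ _ ((fun m : nat => (m%:R : R) `^ (k%:R^-1)) @` `I_N)).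
  move=> l [Ll [_ [_ lX]]]; have l0 := Lambda_gt0 k_ge2 Ll.
  case: Ll => b [_ [_ [_ El]]]; exists (\prod_(1 <= i < k) b i ^ (k + i))%N => //=.
  rewrite -(ltr_nat R) -(inLambda_radical k_ge2 El); apply: le_lt_trans (truncnS_gt _).
  by rewrite lerXn2r // ?nnegrE ?(le_trans _ lX) ?ltW.
exact/finite_image/finite_II.
Qed.

Definition others (X : R) : seq R := enum_fset (fset_set (others_set X)).

Lemma others_uniq X : uniq (others X).
Proof. exact: fset_uniq. Qed.

Lemma mem_others X l : reflect (others_set X l) (l \in others X).
Proof.
have -> : (l \in others X) = (l \in others_set X).
  by rewrite -(in_fset_set (finite_others X)).
by apply: (iffP idP); rewrite inE.
Qed.

Lemma partial_prodE X : partial_prod k I J X = \prod_(l <- others X) (1 - 2 / l).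
Proof. by rewrite /partial_prod fsbig_finite //; exact: finite_others. Qed.

Lemma two_div_Lambda (l : R) : inLambda k l -> 0 < 2 / l < 1.
Proof.
move=> Ll; have l0 := Lambda_gt0 k_ge2 Ll; have l2 := inLambda_gt2 k_ge2 Ll.
by rewrite divr_gt0 // ltr_pdivrMr // mul1r.
Qed.

Lemma partial_prod_gt0 X : 0 < partial_prod k I J X.
Proof.
rewrite partial_prodE big_seq; apply: prodr_gt0 => l /mem_others[Ll _].
by have := two_div_Lambda Ll; lra.
Qed.

Lemma partial_prod_le1 X : partial_prod k I J X <= 1.
Proof.
rewrite partial_prodE big_seq; apply: prodr_ile1 => l /mem_others[Ll _].
by have := two_div_Lambda Ll; lra.
Qed.

Lemma partial_prod_split X Y : X <= Y -> partial_prod k I J Y =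
  partial_prod k I J X * \prod_(l <- others Y | X < l) (1 - 2 / l).
Proof.
move=> XY; rewrite !partial_prodE (bigID (fun l => X < l)) /= mulrC; congr (_ * _).
rewrite -big_filter; apply: perm_big; apply: uniq_perm.
- exact/filter_uniq/others_uniq.
- exact: others_uniq.
move=> l; rewrite mem_filter -leNgt; apply/andP/mem_others.
  by move=> [lX /mem_others[? [? [? _]]]].
move=> [? [? [? lX]]]; split => //; apply/mem_others; do !split => //.
exact: le_trans XY.
Qed.

Lemma partial_prod_noninc X Y : X <= Y -> partial_prod k I J Y <= partial_prod k I J X.
Proof.
move=> XY; rewrite (partial_prod_split XY) ler_piMr ?(ltW (partial_prod_gt0 _)) //.
rewrite big_seq_cond; apply: prodr_ile1 => l /andP[/mem_others[Ll _] _].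
by have := two_div_Lambda Ll; lra.
Qed.

(** By [prod_1B_ge] the factors beyond [X] lose at most [2 * \sum 1 / l]. The loss is relative,
    which keeps the limit positive. *)
Lemma partial_prod_tail (e : R) : 0 < e -> exists X0, forall X Y, X0 <= X -> X <= Y ->
  partial_prod k I J X * (1 - 2 * e) <= partial_prod k I J Y.
Proof.
move=> e0; have [X0 h] := Lambda_sum_tail k_ge2 e0; exists X0 => X Y X0X XY.
rewrite (partial_prod_split XY) ler_wpM2l ?(ltW (partial_prod_gt0 _)) //.
rewrite -big_filter; set s := [seq l <- others Y | X < l].
have sP l : l \in s -> inLambda k l /\ X0 < l.
  rewrite mem_filter => /andP[Xl /mem_others[Ll _]]; split => //.
  exact: le_lt_trans Xl.
apply: le_trans (prod_1B_ge _) => [|l /sP[/two_div_Lambda/andP[? ?] _]]; last first.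
  by rewrite !ltW.
rewrite lerD2l lerN2 -mulr_sumr ler_pM2l //; apply: h => //.
exact/filter_uniq/others_uniq.
Qed.

Definition limit_prod : R := inf (range (partial_prod k I J)).

Lemma limit_prod_le X : limit_prod <= partial_prod k I J X.
Proof.
apply: ge_inf; last by exists X.
by exists 0 => _ [Y _ <-]; exact/ltW/partial_prod_gt0.
Qed.

Lemma limit_prod_ge (e : R) : 0 < e -> exists X0, forall X, X0 <= X ->
  partial_prod k I J X * (1 - 2 * e) <= limit_prod.
Proof.
move=> e0; have [X0 h] := partial_prod_tail e0; exists X0 => X X0X.
apply: lb_le_inf; first by exists (partial_prod k I J 0), 0.
move=> _ [Y _ <-]; have [XY|YX] := leP X Y; first exact: h.
apply: le_trans (partial_prod_noninc (ltW YX)).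
by rewrite ler_piMr ?(ltW (partial_prod_gt0 _)) // gerBl mulr_ge0 // ltW.
Qed.

Lemma limit_prod_gt0 : 0 < limit_prod.
Proof.
have e0 : (0 : R) < 4^-1 by rewrite invr_gt0.
have [X0 /(_ _ (lexx _)) h] := limit_prod_ge e0; apply: lt_le_trans h.
by rewrite mulr_gt0 ?partial_prod_gt0 //; lra.
Qed.

Lemma limit_prod_close (e : R) : 0 < e -> exists X0, forall X, X0 <= X ->
  `|partial_prod k I J X - limit_prod| <= e.
Proof.
move=> e0; have e2 : 0 < e / 2 by rewrite divr_gt0.
have [X0 h] := limit_prod_ge e2; exists X0 => X /h hX.
rewrite ger0_norm ?subr_ge0 ?limit_prod_le //.
by have := partial_prod_le1 X; have := partial_prod_gt0 X; nra.
Qed.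

(** [hit_frac] telescopes, and [frac (s / l) <= s / l]. The bound has no additive constant, so it
    can be summed over [l]. *)
Lemma sum_hit_le (l : R) s N : inLambda k l ->
  \sum_(n < N) (hit l (n + s))%:R <= (N + s)%:R * l^-1.
Proof.
move=> Ll; have l0 := Lambda_gt0 k_ge2 Ll.
have -> : \sum_(n < N) (hit l (n + s))%:R =
  N%:R * l^-1 + frac (s%:R * l^-1) - frac ((N + s)%:R * l^-1).
  elim: N => [|N IH]; first by rewrite big_ord0 mul0r !add0r subrr.
  by rewrite big_ord_recr /= IH (hit_frac k_ge2 _ Ll) addSn -(natr1 N); ring.
have f0 := frac_ge0 ((N + s)%:R * l^-1).
have fs : frac (s%:R * l^-1) <= s%:R * l^-1.
  by rewrite gerBl ler0z floor_ge0 mulr_ge0 // invr_ge0 ltW.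
by rewrite [in leRHS]natrD [in leRHS]mulrDl; lra.
Qed.

(** The index is shifted by one because [inB] requires [0 < n]. On Lambda the last branch is 0 or 1,
    by [hit_next]. *)
Definition factor (l : R) (n : nat) : R :=
  if l \in I then (hit l n.+1)%:R else if l \in J then (hit l n.+2)%:R
  else 1 - (hit l n.+1)%:R - (hit l n.+2)%:R.

Definition factor_mean (l : R) : R :=
  if (l \in I) || (l \in J) then l^-1 else 1 - 2 / l.

Lemma factor_bool l n : inLambda k l -> factor l n =
  (if l \in I then hit l n.+1 else if l \in J then hit l n.+2
   else ~~ hit l n.+1 && ~~ hit l n.+2)%:R.
Proof.
move=> Ll; rewrite /factor; case: ifP => // _; case: ifP => // _.
have := @hit_next _ _ k_ge2 l n.+1 Ll.
by case: (hit l n.+1) => [/(_ isT)/negPf ->|_]; case: (hit l n.+2) => /=; ring.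
Qed.

Lemma factor_approximable l : inLambda k l -> approximable l^-1 (factor l) (factor_mean l).
Proof.
move=> Ll; have h1 := approximable_shift (hit_approximable k_ge2 Ll).
have h2 := approximable_shift h1.
rewrite /factor_mean; have [lI|nI] /= := boolP (l \in I).
  by rewrite (_ : factor l = fun n => (hit l n.+1)%:R) //; apply/funext => n; rewrite /factor lI.
have [lJ|nJ] := boolP (l \in J).
  rewrite (_ : factor l = fun n => (hit l n.+2)%:R) //.
  by apply/funext => n; rewrite /factor (negPf nI) lJ.
have -> : 1 - 2 / l = 1 + - l^-1 + - l^-1 by ring.
have -> : factor l = fun n => 1 + - (hit l n.+1)%:R + - (hit l n.+2)%:R.
  by apply/funext => n; rewrite /factor (negPf nI) (negPf nJ).
apply: approximableD (approximableN h2).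
exact: approximableD (approximable_cst _ _) (approximableN h1).
Qed.

Let Lset X := I ++ J ++ others X.

Lemma Lset_uniq X : uniq (Lset X).
Proof.
rewrite !cat_uniq uI uJ others_uniq /= andbT -all_predC; apply/andP; split.
  apply/allP => l; rewrite mem_cat /= => /orP[lJ|/mem_others[_ []]] //.
  by apply/negP => /IJ; rewrite lJ.
by rewrite -all_predC; apply/allP => l /mem_others[_ [_ []]].
Qed.

Lemma Lset_Lambda X l : l \in Lset X -> inLambda k l.
Proof. by rewrite !mem_cat => /orP[/IL|/orP[/JL|/mem_others[]]]. Qed.

Lemma factor_has_mean X : has_mean (fun n => \prod_(l <- Lset X) factor l n)
  ((\prod_(l <- I ++ J) l^-1) * partial_prod k I J X).
Proof.
have -> : (\prod_(l <- I ++ J) l^-1) * partial_prod k I J X =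
  \prod_(l <- Lset X) factor_mean l.
  rewrite partial_prodE /Lset catA [RHS]big_cat /=; congr (_ * _).
    rewrite !big_seq; apply: eq_bigr => l; rewrite mem_cat /factor_mean => -> //.
  rewrite big_seq [RHS]big_seq; apply: eq_bigr => l /mem_others[_ [/negPf nI [/negPf nJ _]]].
  by rewrite /factor_mean nI nJ.
apply: has_mean_prod.
- exact: Lset_uniq.
- apply: (Lambda_zfree k_ge2 (Lset_uniq X)) => l; exact: Lset_Lambda.
- move=> l n /Lset_Lambda Ll; rewrite factor_bool // normr_nat.
  by case: (if _ then _ else _).
- by move=> l /Lset_Lambda; exact: factor_approximable.
Qed.

(** The two sides can differ only if some [l > X] outside [I] and [J] hits [n.+1] or [n.+2]. Such a
    hit forces [l <= n + 3 <= N + 2], so a finite sum catches it. *)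
Lemma inB_factor_dist X (n N : nat) : (n < N)%N ->
  `|(`[< inB k I J n.+1 >])%:R - \prod_(l <- Lset X) factor l n| <=
  \sum_(l <- others (N + 2)%:R | X < l) ((hit l (n + 1))%:R + (hit l (n + 2))%:R).
Proof.
move=> nN; rewrite !addn1 !addn2.
have S0 : 0 <= \sum_(l <- others (N.+2)%:R | X < l) ((hit l n.+1)%:R + (hit l n.+2)%:R) :> R.
  by apply: sumr_ge0.
have hB := inB_hit k_ge2 n.+1 uI uJ IL JL.
have [/asboolP/hB[_ /allP hI /allP hJ hK]|nB] := boolP `[< inB k I J n.+1 >].
  rewrite big_seq big1 ?subrr ?normr0 // => l lL.
  rewrite factor_bool; last exact: Lset_Lambda lL.
  have [/hI -> //|nI] := boolP (l \in I); have [/hJ -> //|nJ] := boolP (l \in J).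
  by rewrite hK //; exact: Lset_Lambda lL.
rewrite sub0r normrN.
have [/hasP[l lL fl]|/hasPn nz] := boolP (has (fun l => factor l n == 0) (Lset X)).
  by rewrite (bigD1_seq l) ?Lset_uniq //= (eqP fl) mul0r normr0.
have f1 l : l \in Lset X -> (if l \in I then hit l n.+1 else if l \in J then hit l n.+2
   else ~~ hit l n.+1 && ~~ hit l n.+2).
  move=> lL; have := nz _ lL; rewrite factor_bool; last exact: Lset_Lambda lL.
  by rewrite pnatr_eq0 eqb0 negbK.
rewrite big_seq big1 ?normr1; last first.
  by move=> l lL; rewrite factor_bool ?f1 //; exact: Lset_Lambda lL.
have [l [Ll nI nJ hl]] : exists l : R, [/\ inLambda k l, l \notin I, l \notin J &
    hit l n.+1 || hit l n.+2].
  apply: contrapT => no; move/asboolP: nB; apply; apply/hB; split => //.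
  - by apply/allP => l lI; have := f1 l; rewrite !mem_cat lI; exact.
  - apply/allP => l lJ; have := f1 l; rewrite !mem_cat lJ orbT.
    by case: ifP => [/IJ|_]; rewrite ?lJ //; exact.
  - move=> l Ll lI lJ; rewrite -negb_or; apply/negP => hl; apply: no; by exists l.
have Xl : X < l.
  rewrite ltNge; apply/negP => lX; have := f1 l.
  have lo : l \in others X by apply/mem_others.
  rewrite !mem_cat lo !orbT (negPf nI) (negPf nJ) -negb_or hl => /(_ isT) //.
have l0 := Lambda_gt0 k_ge2 Ll.
have bnd (m : nat) : hit l m -> l <= m.+1%:R.
  move=> /asboolP[a /andP[h1 /ltW]]; apply: le_trans.
  have a0 : (0 < a)%N.
    by case: a h1 => //; rewrite mul0r => h0; have := ler0n R m; rewrite leNgt h0.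
  by rewrite ler_peMl ?(ltW l0) // ler1n.
have lo : l \in others N.+2%:R.
  apply/mem_others; do !split => //.
  case/orP: hl => /bnd /le_trans; apply; rewrite ler_nat ltnS; last by [].
  exact: leqW.
rewrite -big_filter (bigD1_seq l) ?mem_filter ?Xl ?filter_uniq ?others_uniq //=.
rewrite ler_wpDr //; first by apply: sumr_ge0.
by move: hl; case: (hit l n.+1); case: (hit l n.+2) => //= _; rewrite ?addr0 ?add0r // lerDl.
Qed.

Lemma inB_has_mean : has_mean (fun n => (`[< inB k I J n.+1 >])%:R)
  ((\prod_(l <- I ++ J) l^-1) * limit_prod).
Proof.
set c := \prod_(l <- I ++ J) l^-1.
have c0 : 0 <= c.
  rewrite /c big_seq; apply: prodr_ge0 => l; rewrite mem_cat invr_ge0.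
  by case/orP => [/IL|/JL] /(Lambda_gt0 k_ge2)/ltW.
apply: has_mean_close => e e0.
have e5 : 0 < e / 5 by rewrite divr_gt0.
have ec : 0 < e / (c + 1) by rewrite divr_gt0 // ltr_wpDl.
have [X1 h1] := Lambda_sum_tail k_ge2 e5; have [X2 h2] := limit_prod_close ec.
pose X := Num.max X1 X2.
exists (fun n => \prod_(l <- Lset X) factor l n), (c * partial_prod k I J X); split.
- exact: factor_has_mean.
- rewrite -mulrBr normrM (ger0_norm c0).
  apply: (@le_trans _ _ ((c + 1) * (e / (c + 1)))).
    by rewrite ler_pM ?lerDl // h2 // le_max lexx orbT.
  by rewrite mulrC divfK // gt_eqF // ltr_wpDl.
exists 1%N => N N1.
apply: (@le_trans _ _ (\sum_(n < N) \sum_(l <- others (N + 2)%:R | X < l)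
    ((hit l (n + 1))%:R + (hit l (n + 2))%:R))).
  by apply: ler_sum => n _; exact: inB_factor_dist.
rewrite exchange_big /= -(big_filter (others (N + 2)%:R) (fun l => X < l)).
set s := [seq l <- others (N + 2)%:R | X < l].
have sP l : l \in s -> inLambda k l /\ X1 < l.
  rewrite mem_filter /= /X gt_max => /andP[/andP[? _] /mem_others[? _]]; by split.
(* For [N >= 1], [(N + 1) + (N + 2) <= 5 N]; hence the tolerance [e / 5]. *)
apply: (@le_trans _ _ (\sum_(l <- s) (5 * N%:R) * l^-1)).
  rewrite big_seq [leRHS]big_seq; apply: ler_sum => l /sP[Ll _].
  rewrite big_split /=; have := sum_hit_le 1 N Ll; have := sum_hit_le 2 N Ll.
  have l0 : 0 < l^-1 by rewrite invr_gt0 (Lambda_gt0 k_ge2 Ll).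
  have N1' : 1 <= (N%:R : R) by rewrite ler1n.
  rewrite !natrD !mulrDl => a b; have : l^-1 <= N%:R * l^-1 by rewrite ler_peMl // ltW.
  by rewrite -mulrA; lra.
rewrite -mulr_sumr mulrAC mulrC.
have hs : \sum_(l <- s) l^-1 <= e / 5.
  by apply: h1 => //; exact/filter_uniq/others_uniq.
rewrite [leLHS](_ : _ = (5 * \sum_(l <- s) l^-1) * N%:R); last by ring.
by rewrite ler_wpM2r //; lra.
Qed.

Lemma partial_prod_cvg : partial_prod k I J X @[X --> +oo] --> limit_prod.
Proof.
apply/cvgrPdist_le => e e0; have [X0 h] := limit_prod_close e0.
exists X0; split; first exact: num_real.
by move=> X X0X; rewrite distrC; apply/h/ltW.
Qed.

Lemma countB_cvg : (countB k I J x)%:R / x @[x --> +oo] -->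
  (\prod_(l <- I ++ J) l^-1) * limit_prod.
Proof.
set D := _ * limit_prod; have hD : has_mean _ D := inB_has_mean.
apply/cvgrPdist_le => e e0; have e2 : 0 < e / 2 by rewrite divr_gt0.
have [N0 h] := hD _ e2.
(* The quotient is by [x] and the mean by its floor [N]; the discrepancy is at most [|D|], which
   this threshold makes at most [e / 2 * x]. *)
exists (N0%:R + `|D| / (e / 2) + 1); split; first exact: num_real.
move=> x hx; pose N := Num.truncn x.
have D0 : 0 <= `|D| / (e / 2) by rewrite divr_ge0 // ltW.
have N00 := ler0n R N0.
have x0 : 0 < x by lra.
have /andP[Nx xN] : N%:R <= x < N.+1%:R by apply: truncn_itv; exact: ltW.
have N0N : (N0 <= N)%N by rewrite -ltnS -(ltr_nat R); lra.
have Dx : `|D| <= e / 2 * x by rewrite mulrC -ler_pdivrMr //; lra.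
have -> : D - (countB k I J x)%:R / x = (D * x - (countB k I J x)%:R) / x.
  by field; exact: lt0r_neq0.
rewrite normrM [X in _ * X]gtr0_norm ?invr_gt0 // ler_pdivrMr //.
rewrite /countB count_iota1 -/N.
have := h _ N0N; set S := \sum_(n < N) _ => hS.
have -> : D * x - S = - (S - D * N%:R) + D * (x - N%:R) by ring.
apply: (le_trans (ler_normD _ _)); rewrite normrN normrM.
have xN1 : `|x - N%:R| <= 1 by rewrite ger0_norm ?subr_ge0 //; move: xN; rewrite -natr1; lra.
have : `|D| * `|x - N%:R| <= `|D| by rewrite ler_piMr.
have : e / 2 * N%:R <= e / 2 * x by rewrite ler_pM2l.
lra.
Qed.

End Density.

Theorem theorem1 (R : realType) (k : nat) (I J : seq R) :
  (2 <= k)%N ->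
  uniq I -> uniq J ->
  (forall l, l \in I -> inLambda k l) ->
  (forall l, l \in J -> inLambda k l) ->
  (forall l, l \in I -> l \notin J) ->
  exists P : R,
    (partial_prod k I J X @[X --> +oo] --> P) /\
    ((countB k I J x)%:R / x @[x --> +oo] --> (\prod_(l <- I ++ J) l^-1) * P) /\
    0 < (\prod_(l <- I ++ J) l^-1) * P.
Proof.
move=> k2 uI uJ IL JL IJ; exists (limit_prod k I J); split; last split.
- exact: partial_prod_cvg.
- exact: countB_cvg.
- rewrite mulr_gt0 ?limit_prod_gt0 // big_seq; apply: prodr_gt0 => l.
  by rewrite mem_cat invr_gt0 => /orP[/IL|/JL]; exact: Lambda_gt0.
Qed.
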